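(* Let $(M,K)$ be a Cartan space and let $k<0<c$ be two constants with $-c^2k=1$. Then the following are equivalent: (1) $(M,K)$ is a Cartan space of constant curvature $k$; (2) $G$ is bundle-like on $I^*M(c)$ for $\xi$; (3) $\xi$ is a Killing vector field on $I^*M(c)$ (with respect to the restriction of $G$ to $I^*M(c)$); (4) the angular curvature $\wedge^*$ vanishes on $I^*M(c)$, i.e. $\wedge^*_{ij}(x,p)=0$ for all $i,j$ and all $(x,p)\in I^*M(c)$.
   Context: Let $M$ be a real $n$-dimensional smooth manifold with cotangent bundle $\pi^*:T^*M\to M$, local coordinates $(x^i)$ on $M$, induced coordinates $(x^i,p_i)$ on $T^*M$, and $\partial^i:=\partial/\partial p_i$; repeated indices are summed. A Cartan space is a pair $(M,K)$, where $K=K(x,p)$ is a real positive function on $T^*M$, smooth off the zero section and continuous on it, positively $1$-homogeneous in $p$, such that $g^{ij}(x,p)=\frac12\partial^i\partial^jK^2$ is positive definite off the zero section. All objects below live on $T^*M$ with the zero section removed. Let $(g_{ij})=(g^{ij})^{-1}$ and $\{f,h\}=\frac{\partial f}{\partial p_i}\frac{\partial h}{\partial x^i}-\frac{\partial h}{\partial p_i}\frac{\partial f}{\partial x^i}$. The canonical nonlinear connection is $$N_{ij}=\tfrac14\{g_{ij},K^2\}-\tfrac14\Big(g_{ik}\tfrac{\partial^2K^2}{\partial p_k\partial x^j}+g_{jk}\tfrac{\partial^2K^2}{\partial p_k\partial x^i}\Big).$$ Set $\frac{\delta}{\delta x^i}=\frac{\partial}{\partial x^i}+N_{ij}\partial^j$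 and $\delta p_i=dp_i-N_{ij}dx^j$. The Sasaki-type metric is $G=g_{ij}dx^i\otimes dx^j+g^{ij}\delta p_i\otimes\delta p_j$, with Levi-Civita connection $\nabla$. Let $\xi=p_ig^{ij}\frac{\delta}{\delta x^j}$. For $c>0$ let $I^*M(c)=\{(x,p)\in T^*M: K(x,p)=c\}$; $\xi$ is tangent to $I^*M(c)$. ''$G$ is bundle-like on $I^*M(c)$ for $\xi$'' means $G(\nabla_XY,\xi)+G(\nabla_YX,\xi)=0$ for all vector fields $X,Y$ tangent to $I^*M(c)$ and $G$-orthogonal to $\xi$. Let $R_{ijk}=\frac{\delta N_{jk}}{\delta x^i}-\frac{\delta N_{ik}}{\delta x^j}$, $R_{ij}=p_hg^{hk}R_{ikj}$ (symmetric in $i,j$), and let $h_{ij}=g_{ij}-\frac1{K^2}p_ip_j$ be the angular metric. The angular curvature is $\wedge^*_{ij}=R_{ij}+h_{ij}$. The Cartan space $(M,K)$ is of constant curvature $k$ if and only if $R_{ij}=kK^2h_{ij}$ everywhere off the zero section; this criterion (with the sign conventions above) is taken as the definition. *)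

(* Defs.v *)
From HB Require Import structures.
From mathcomp Require Import all_boot all_order all_algebra.
From mathcomp Require Import all_classical all_reals all_analysis.
From mathcomp Require Import ring.

Set Implicit Arguments.
Unset Strict Implicit.
Unset Printing Implicit Defensive.

Import Order.TTheory GRing.Theory Num.Theory.
Import numFieldNormedType.Exports.

Local Open Scope classical_set_scope.
Local Open Scope ring_scope.

Definition pd (R : realType) (m : nat) (a : 'I_m) (f : 'rV[R]_m -> R)
  (z : 'rV[R]_m) : R := 'D_(delta_mx 0 a) f z.

(* [Cn k D f] is "f is of class C^k on D"; it is only used for open D. *)
Fixpoint Cn (R : realType) (m k : nat) (D : set 'rV[R]_m) (f : 'rV[R]_m -> R)
  : Prop :=
  match k with
  | 0 => forall z, D z -> {for z, continuous f}
  | k'.+1 => (forall z, D z -> differentiable f z) /\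
             (forall a : 'I_m, Cn k' D (pd a f))
  end.

Definition smooth (R : realType) (m : nat) (D : set 'rV[R]_m)
  (f : 'rV[R]_m -> R) : Prop := forall k, Cn k D f.

Definition smooth_map (R : realType) (m l : nat) (D : set 'rV[R]_m)
  (f : 'rV[R]_m -> 'rV[R]_l) : Prop :=
  forall b : 'I_l, smooth D (fun z => f z 0 b).

Section Coordinates.
Context {R : realType} {m : nat}.
Implicit Types (X Y : 'rV[R]_m -> 'rV[R]_m) (f : 'rV[R]_m -> R).

Definition dir X f z : R := \sum_(a < m) X z 0 a * pd a f z.

Definition lie_bracket X Y z : 'rV[R]_m :=
  \row_b (dir X (fun w => Y w 0 b) z - dir Y (fun w => X w 0 b) z).

Variable gm : 'rV[R]_m -> 'M[R]_m.

Definition inner X Y z : R := \sum_a \sum_b gm z a b * X z 0 a * Y z 0 b.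

(* [christoffel b a d] is Gamma^b_{ad}. *)
Definition christoffel (b a d : 'I_m) (z : 'rV[R]_m) : R :=
  2^-1 * \sum_(e < m) invmx (gm z) b e *
    (pd a (fun w => gm w e d) z + pd d (fun w => gm w e a) z
     - pd e (fun w => gm w a d) z).

Definition nabla X Y z : 'rV[R]_m :=
  \row_b (dir X (fun w => Y w 0 b) z
          + \sum_a \sum_d christoffel b a d z * X z 0 a * Y z 0 d).

(* (L_V g)(X, Y) = V (g(X, Y)) - g([V, X], Y) - g(X, [V, Y]). *)
Definition lie_metric V X Y z : R :=
  dir V (inner X Y) z - inner (lie_bracket V X) Y z
  - inner X (lie_bracket V Y) z.

(* The coefficients above are those of the Levi-Civita connection:
   torsion-free and metric. *)
Lemma pd_near_sym a b d z :
  (\forall w \near z, (gm w)^T = gm w) ->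
  pd d (fun w => gm w a b) z = pd d (fun w => gm w b a) z.
Proof.
move=> gs; apply: near_eq_derive.
by near=> w; rewrite -[in LHS](near gs w) // mxE.
Unshelve. all: by end_near.
Qed.

Lemma christoffel_torsion_free b a d z :
  (\forall w \near z, (gm w)^T = gm w) -> christoffel b a d z = christoffel b d a z.
Proof.
move=> gs; rewrite /christoffel; congr (_ * _); apply: eq_bigr => e _.
by rewrite (pd_near_sym a d) // [X in _ * (X - _)]addrC.
Qed.

Lemma christoffel_metric a b d z :
  (\forall w \near z, (gm w)^T = gm w) -> gm z \in unitmx ->
  pd d (fun w => gm w a b) z =
  \sum_e christoffel e d a z * gm z e b + \sum_e christoffel e d b z * gm z a e.
Proof.
move=> gs gu.
have gsE i j : gm z i j = gm z j i by rewrite -{1}(nbhs_singleton gs) mxE.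
have low i j k : \sum_e christoffel e i j z * gm z k e =
    2^-1 * (pd i (fun w => gm w k j) z + pd j (fun w => gm w k i) z
            - pd k (fun w => gm w i j) z).
  under eq_bigr => e _ do rewrite /christoffel -mulrA mulr_suml.
  rewrite -mulr_sumr exchange_big /=; congr (_ * _).
  have E l : \sum_e gm z k e * invmx (gm z) e l = (k == l)%:R.
    by have := mulmxV gu => /matrixP/(_ k l); rewrite !mxE => <-.
  rewrite (eq_bigr (fun l => (k == l)%:R *
     (pd i (fun w => gm w l j) z + pd j (fun w => gm w l i) z
            - pd l (fun w => gm w i j) z))); last first.
    move=> l _; rewrite -E mulr_suml; apply: eq_bigr => e _.
    by rewrite mulrAC [invmx _ _ _ * _]mulrC.
  rewrite (bigD1 k) //= eqxx mul1r big1 ?addr0 // => l /negPf.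
  by rewrite eq_sym => ->; rewrite mul0r.
under [X in X + _]eq_bigr => e _ do rewrite gsE.
rewrite !low (pd_near_sym b a) // (pd_near_sym b d) // (pd_near_sym a d) //.
by field.
Qed.

End Coordinates.

Record smooth_manifold (R : realType) (n : nat) := SmoothManifold {
  carrier :> topologicalType;
  manifold_hausdorff : hausdorff_space carrier;
  manifold_second_countable : @second_countable carrier;
  chart : Type;
  chart_dom : chart -> set carrier;
  coord : chart -> carrier -> 'rV[R]_n;
  param : chart -> 'rV[R]_n -> carrier;
  chart_dom_open : forall a, open (chart_dom a);
  chart_cover : forall q : carrier, exists a, chart_dom a q;
  coordK : forall a q, chart_dom a q -> param a (coord a q) = q;
  coord_open : forall a, open (coord a @` chart_dom a);
  coord_continuous : forall a q, chart_dom a q -> {for q, continuous (coord a)};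
  param_continuous : forall a x, (coord a @` chart_dom a) x ->
    {for x, continuous (param a)};
  transition_smooth : forall a b,
    smooth_map (coord a @` (chart_dom a `&` chart_dom b))
      (fun x => coord b (param a x))
}.

(** A point of T*M over the domain of the chart a is given by its induced
    coordinates z = row_mx x p in R^(n+n). Functions and vector fields on T*M
    are families indexed by the charts of M that agree under the changes of
    induced coordinates. *)

Section Cotangent.
Context {R : realType} {n : nat} {M : smooth_manifold R n}.

Definition basept (a : chart M) (z : 'rV[R]_(n + n)) : M := param a (lsubmx z).

Definition ct_dom (a : chart M) : set 'rV[R]_(n + n) :=
  [set z | (coord a @` chart_dom a) (lsubmx z)].

Definition slit_dom (a : chart M) : set 'rV[R]_(n + n) :=
  [set z | ct_dom a z /\ rsubmx z != 0].

Definition transition (a b : chart M) (x : 'rV[R]_n) : 'rV[R]_n :=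
  coord b (param a x).

(* ('J f x) i j is the derivative of the j-th component in the direction i, so
   that p_i = (dx'^j / dx^i) p'_j reads p = p' *m J^T. *)
Definition ct_transition (a b : chart M) (z : 'rV[R]_(n + n))
  : 'rV[R]_(n + n) :=
  row_mx (transition a b (lsubmx z))
         (rsubmx z *m invmx ('J (transition a b) (lsubmx z))^T).

End Cotangent.

Record slit_vector_field (R : realType) (n : nat) (M : smooth_manifold R n) :=
  SlitVectorField {
  vf :> chart M -> 'rV[R]_(n + n) -> 'rV[R]_(n + n);
  vf_smooth : forall a, smooth_map (slit_dom a) (vf a);
  vf_compat : forall a b z, slit_dom a z -> chart_dom b (basept a z) ->
    vf b (ct_transition a b z) = vf a z *m 'J (ct_transition a b) z
}.

Section CartanCoordinates.
Context {R : realType} {n : nat}.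
Implicit Types (f h : 'rV[R]_(n + n) -> R) (z : 'rV[R]_(n + n)) (i j k : 'I_n).

Definition pdx i f := pd (lshift n i) f.
Definition pdp i f := pd (rshift n i) f.

Definition momentum z i : R := rsubmx z 0 i.

Definition bracket f h z : R :=
  \sum_i (pdp i f z * pdx i h z - pdp i h z * pdx i f z).

Variable K : 'rV[R]_(n + n) -> R.

Definition Ksq z : R := K z ^+ 2.

Definition gup z : 'M[R]_n := \matrix_(i, j) (2^-1 * pdp i (pdp j Ksq) z).

Definition glo z : 'M[R]_n := invmx (gup z).

Definition Ncoef i j z : R :=
  4^-1 * bracket (fun w => glo w i j) Ksq z
  - 4^-1 * \sum_k (glo z i k * pdp k (pdx j Ksq) z
                   + glo z j k * pdp k (pdx i Ksq) z).

Definition delta i z : 'rV[R]_(n + n) :=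
  delta_mx 0 (lshift n i) + \sum_j Ncoef i j z *: delta_mx 0 (rshift n j).

(* The 1-form delta p_i evaluated on a tangent vector u. *)
Definition deltap i z (u : 'rV[R]_(n + n)) : R :=
  u 0 (rshift n i) - \sum_j Ncoef i j z * u 0 (lshift n j).

Definition sasaki z (u v : 'rV[R]_(n + n)) : R :=
  \sum_i \sum_j glo z i j * u 0 (lshift n i) * v 0 (lshift n j)
  + \sum_i \sum_j gup z i j * deltap i z u * deltap j z v.

Definition sasaki_mx z : 'M[R]_(n + n) :=
  \matrix_(a, b) sasaki z (delta_mx 0 a) (delta_mx 0 b).

Definition xi z : 'rV[R]_(n + n) :=
  \sum_i \sum_j (momentum z i * gup z i j) *: delta j z.

Definition Rcurv i j k z : R :=
  dir (delta i) (Ncoef j k) z - dir (delta j) (Ncoef i k) z.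

Definition Rtensor i j z : R :=
  \sum_h \sum_k momentum z h * gup z h k * Rcurv i k j z.

Definition angular_metric i j z : R :=
  glo z i j - (Ksq z)^-1 * momentum z i * momentum z j.

Definition angular_curvature i j z : R := Rtensor i j z + angular_metric i j z.

End CartanCoordinates.

(* [Kfun a] is the expression of K in the induced coordinates of the chart a.
   On the zero section K vanishes, by homogeneity. *)
Record cartan_space (R : realType) (n : nat) (M : smooth_manifold R n) :=
  CartanSpace {
  Kfun :> chart M -> 'rV[R]_(n + n) -> R;
  K_compat : forall a b z, ct_dom a z -> chart_dom b (basept a z) ->
    Kfun b (ct_transition a b z) = Kfun a z;
  K_pos : forall a z, slit_dom a z -> 0 < Kfun a z;
  K_smooth : forall a, smooth (slit_dom a) (Kfun a);
  K_continuous : forall a z, ct_dom a z -> {for z, continuous (Kfun a)};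
  K_homogeneous : forall a (x p : 'rV[R]_n) (t : R),
    ct_dom a (row_mx x p) -> 0 < t ->
    Kfun a (row_mx x (t *: p)) = t * Kfun a (row_mx x p);
  K_posdef : forall a z (v : 'rV[R]_n), slit_dom a z -> v != 0 ->
    0 < \sum_i \sum_j gup (Kfun a) z i j * v 0 i * v 0 j
}.

Section Conditions.
Context {R : realType} {n : nat} {M : smooth_manifold R n}.
Variables (K : cartan_space M).
Implicit Types X Y : slit_vector_field M.

Definition constant_curvature (k : R) : Prop :=
  forall a z, slit_dom a z -> forall i j,
    Rtensor (K a) i j z = k * Ksq (K a) z * angular_metric (K a) i j z.

Variable c : R.

Definition indicatrix (a : chart M) : set 'rV[R]_(n + n) :=
  [set z | slit_dom a z /\ K a z = c].

Definition G (a : chart M) := inner (sasaki_mx (K a)).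

(* For c > 0, K has no critical point on I*M(c), so that the tangent space of
   I*M(c) is the kernel of dK. Vector fields on I*M(c) are given by vector
   fields on T*M minus the zero section that are tangent to I*M(c) along it. *)
Definition tangent_to_indicatrix X : Prop :=
  forall a z, indicatrix a z -> dir (X a) (K a) z = 0.

Definition orthogonal_to_xi X : Prop :=
  forall a z, indicatrix a z -> G a (X a) (xi (K a)) z = 0.

Definition bundle_like : Prop :=
  forall X Y, tangent_to_indicatrix X -> tangent_to_indicatrix Y ->
    orthogonal_to_xi X -> orthogonal_to_xi Y ->
    forall a z, indicatrix a z ->
      G a (nabla (sasaki_mx (K a)) (X a) (Y a)) (xi (K a)) z
      + G a (nabla (sasaki_mx (K a)) (Y a) (X a)) (xi (K a)) z = 0.

(* The Lie derivative along xi of the metric induced on I*M(c) vanishes: for X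
   and Y tangent to I*M(c), the function G(X, Y) and the brackets [xi, X],
   [xi, Y] restrict to the corresponding objects of I*M(c). *)
Definition xi_killing : Prop :=
  forall X Y, tangent_to_indicatrix X -> tangent_to_indicatrix Y ->
    forall a z, indicatrix a z ->
      lie_metric (sasaki_mx (K a)) (xi (K a)) (X a) (Y a) z = 0.

Definition angular_curvature_vanishes : Prop :=
  forall a z, indicatrix a z -> forall i j, angular_curvature (K a) i j z = 0.

End Conditions.

(* Main.v *)
(** The field [xi] is the Hamiltonian vector field of [K ^ 2 / 2], and the
    canonical nonlinear connection is exactly the one for which the horizontal
    and the vertical blocks of the Lie derivative of [G] along [xi] vanish. On
    vector fields tangent to the level sets of [K] the remaining mixed block is
    the angular curvature contracted with [g^ij]; it annihilates [p_i g^ij], hence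
    is determined by its values on the vectors orthogonal to [xi].
    As [G(-, xi)] is the Liouville form [p_i dx^i], for [X] and [Y] tangent to
    the indicatrix and orthogonal to [xi] one has
    [G(nabla_X Y, xi) + G(nabla_Y X, xi) = - (L_xi G)(X, Y)], so (4) implies (3)
    and (3) implies (2). For (2) => (4), evaluate this at vector fields with
    prescribed value at a point; they are obtained from local ones by a smooth
    cutoff on the base. Finally (1) and (4) agree on the indicatrix because
    [c ^ 2 * k = - 1], and both sides of (1) are homogeneous of degree 2 in the
    momenta. *)

Require Import Defs.
From HB Require Import structures.
From mathcomp Require Import all_boot all_order all_algebra.
From mathcomp Require Import all_classical all_reals all_analysis.
From mathcomp Require Import ring lra.

Set Implicit Arguments.
Unset Strict Implicit.
Unset Printing Implicit Defensive.

Import Order.TTheory GRing.Theory Num.Theory.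
Import numFieldNormedType.Exports.

Local Open Scope classical_set_scope.
Local Open Scope ring_scope.

(** Two difficulties shape the proof. The tensor calculus is handled by splitting a tangent vector
    at a point into the row vectors [hor] and [ver] of its components in the frame of the
    [delta K i] and the d/dp_i; there the metric is block diagonal and L_xi G becomes a matrix
    identity. With p^i = p_j g^ij, B the matrix of the dp^k/dx^i and H the Hamiltonian field, N = -
    1/2 (H(g) + g B^T + B g). Differentiating p^i g_ij = p_j along H and using Euler's relation
    gives p^i N_ij = - 1/2 dK^2/dx^j, so [xi] is H; read backwards, the formula for N then gives
    xi(g). The other difficulty is that the conditions concern global fields, and only along K = c.
    A function known only there is differentiated in tangent directions through a retraction onto
    the level. Conversely, a vector at one point is extended to a field meeting the conditions on
    every level; they are pointwise linear, so a cutoff depending on the base point alone preserves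
    them, and its support, compact and hence closed in M, makes the extension by zero smooth. *)

(** * Differential calculus on row vectors: functions, matrices, compositions *)

Lemma near_eq_differentiable (R : realType) (V W : normedModType R)
    (f g : V -> W) (x : V) :
  (\forall w \near x, f w = g w) -> differentiable g x -> differentiable f x.
Proof.
move=> fg dg.
have dc : continuous ('d g x) by exact: diff_continuous.
have E : f \o shift x = cst (f x) + 'd g x +o_ 0 id.
  have /eqaddoP Eg := diff_locally dg.
  apply/eqaddoP => e e0; have Eg' := Eg e e0.
  move: (fg); rewrite (near_shift 0 x) => fg'.
  apply: filterS2 fg' Eg' => h; rewrite /= subr0 => Eh.
  by rewrite /GRing.add /GRing.opp /= Eh (nbhs_singleton fg).
have dE : 'd f x = 'd g x :> (V -> W) by exact: diff_unique.
by apply/diff_locallyP; rewrite dE.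
Qed.

Section Calculus.
Context {R : realType} {m : nat}.
Implicit Types (f g : 'rV[R]_m -> R) (V : 'rV[R]_m -> 'rV[R]_m) (z : 'rV[R]_m)
  (D : set 'rV[R]_m).

Lemma differentiable_funD f g z : differentiable f z -> differentiable g z ->
  differentiable (fun w => f w + g w) z.
Proof. exact: differentiableD. Qed.

Lemma differentiable_funM f g z : differentiable f z -> differentiable g z ->
  differentiable (fun w => f w * g w) z.
Proof. exact: differentiableM. Qed.

Lemma differentiable_funN f z : differentiable f z ->
  differentiable (fun w => - f w) z.
Proof. exact: differentiableN. Qed.

Lemma near_eq_pd f g a z :
  (\forall w \near z, f w = g w) -> pd a f z = pd a g z.
Proof. by move=> fg; apply: near_eq_derive. Qed.

Lemma pdE f z a : differentiable f z -> pd a f z = 'd f z (delta_mx 0 a).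
Proof. exact: deriveE. Qed.

Lemma diff_pd f z v : differentiable f z ->
  'd f z v = \sum_a v 0 a * pd a f z.
Proof.
move=> df; rewrite [in LHS](row_sum_delta v) linear_sum /=.
by apply: eq_bigr => a _; rewrite linearZ /= pdE.
Qed.

Lemma dirE V f z : differentiable f z -> dir V f z = 'd f z (V z).
Proof. by move=> df; rewrite diff_pd. Qed.

Lemma near_eq_dir V f g z :
  (\forall w \near z, f w = g w) -> dir V f z = dir V g z.
Proof. by move=> fg; apply: eq_bigr => a _; rewrite (near_eq_pd _ fg). Qed.

Lemma pd_dir a f z : pd a f z = dir (fun=> delta_mx 0 a) f z.
Proof.
rewrite /dir (bigD1 a) //= mxE !eqxx mul1r big1 ?addr0 // => b ba.
by rewrite mxE (negPf ba) mul0r.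
Qed.

Lemma dir_cst V c z : dir V (fun=> c) z = 0.
Proof. by rewrite dirE // (_ : (fun=> c) = cst c) // diff_cst. Qed.

Lemma dirD V f g z : differentiable f z -> differentiable g z ->
  dir V (fun w => f w + g w) z = dir V f z + dir V g z.
Proof.
move=> df dg; rewrite !dirE //; last exact: differentiable_funD.
by rewrite -[RHS]/(('d f z \+ 'd g z) (V z)) -diffD.
Qed.

Lemma dirN V f z : differentiable f z -> dir V (fun w => - f w) z = - dir V f z.
Proof.
move=> df; rewrite !dirE //; last exact: differentiable_funN.
exact: (congr1 (@^~ (V z)) (diffN df)).
Qed.

Lemma dirB V f g z : differentiable f z -> differentiable g z ->
  dir V (fun w => f w - g w) z = dir V f z - dir V g z.
Proof. by move=> df dg; rewrite dirD ?dirN //; apply: differentiable_funN. Qed.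

Lemma dirM V f g z : differentiable f z -> differentiable g z ->
  dir V (fun w => f w * g w) z = dir V f z * g z + f z * dir V g z.
Proof.
move=> df dg; rewrite !dirE //; last exact: differentiable_funM.
etransitivity; first exact: (congr1 (@^~ (V z)) (diffM df dg)).
by rewrite -[LHS]/(f z * 'd g z (V z) + g z * 'd f z (V z)) addrC [g z * _]mulrC.
Qed.

Lemma dirZ V (c : R) f z : differentiable f z ->
  dir V (fun w => c * f w) z = c * dir V f z.
Proof. by move=> df; rewrite dirM // dir_cst mul0r add0r. Qed.

Lemma dirV V f z : differentiable f z -> f z != 0 ->
  dir V (fun w => (f w)^-1) z = - (dir V f z * ((f z)^-1 * (f z)^-1)).
Proof.
move=> df f0; rewrite !dirE //; last exact: differentiableV.
etransitivity; first exact: (congr1 (@^~ (V z)) (diffV df f0)).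
rewrite -[LHS]/(- (f z) ^- 2 * 'd f z (V z)) -invfM -expr2 mulNr.
by rewrite [in RHS]mulrC.
Qed.

Lemma differentiable_bigsum (I : Type) (r : seq I) (P : pred I)
    (F : I -> 'rV[R]_m -> R) z :
  (forall i, P i -> differentiable (F i) z) ->
  differentiable (fun w => \sum_(i <- r | P i) F i w) z.
Proof.
move=> dF; elim: r => [|i r IH].
  by rewrite (_ : (fun w => _) = cst 0) // funeqE => w; rewrite big_nil.
rewrite (_ : (fun w => _) = fun w => (if P i then F i w else 0) +
   \sum_(i <- r | P i) F i w); last first.
  by rewrite funeqE => w; rewrite big_cons; case: (P i); rewrite ?add0r.
by apply: differentiable_funD => //; case Pi: (P i) => //; exact: dF.
Qed.

Lemma dir_sum V (I : Type) (r : seq I) (P : pred I)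
    (F : I -> 'rV[R]_m -> R) z :
  (forall i, P i -> differentiable (F i) z) ->
  dir V (fun w => \sum_(i <- r | P i) F i w) z = \sum_(i <- r | P i) dir V (F i) z.
Proof.
move=> dF; elim: r => [|i r IH].
  rewrite big_nil (_ : (fun w => _) = fun=> 0) ?dir_cst //.
  by rewrite funeqE => w; rewrite big_nil.
rewrite big_cons -IH (_ : (fun w => _) = fun w => (if P i then F i w else 0) +
   \sum_(i <- r | P i) F i w); last first.
  by rewrite funeqE => w; rewrite big_cons; case: (P i); rewrite ?add0r.
rewrite dirD; last exact: differentiable_bigsum; last by case Pi: (P i) => //; exact: dF.
by case: (P i) => //; rewrite dir_cst add0r.
Qed.

Lemma differentiable_coordr (a : 'I_m) z : differentiable (fun w : 'rV[R]_m => w 0 a) z.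
Proof. exact: differentiable_coord. Qed.

Lemma derive_coord (a : 'I_m) (v z : 'rV[R]_m) :
  'D_v ((fun w => w 0 a) : 'rV[R]_m -> R) z = v 0 a.
Proof.
apply: cvg_lim => //=; apply: cvg_near_cst.
near=> h; rewrite /= !mxE addrK [_ *: _]mulrA mulVf ?mul1r //.
by near: h; exact: nbhs_dnbhs_neq.
Unshelve. all: by end_near. Qed.

Lemma dir_coord V (a : 'I_m) z : dir V (fun w => w 0 a) z = V z 0 a.
Proof.
rewrite dirE; last exact: differentiable_coordr.
by rewrite -deriveE ?derive_coord //; exact: differentiable_coordr.
Qed.

Lemma pd_coord (a b : 'I_m) z : pd a (fun w => w 0 b) z = (a == b)%:R.
Proof. by rewrite /pd derive_coord mxE eqxx eq_sym. Qed.

Lemma dir_ext (V W : 'rV[R]_m -> 'rV[R]_m) f z : V z = W z -> dir V f z = dir W f z.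
Proof. by rewrite /dir => ->. Qed.

Definition mdiff (r s : nat) (A : 'rV[R]_m -> 'M[R]_(r, s)) z :=
  forall i j, differentiable (fun w => A w i j) z.

(** The Leibniz rule for this derivative lets the tensor computations be carried out with matrix
    products instead of index sums. *)
Definition dmx V (r s : nat) (A : 'rV[R]_m -> 'M[R]_(r, s)) z : 'M[R]_(r, s) :=
  \matrix_(i, j) dir V (fun w => A w i j) z.

Lemma mdiffM (r s t : nat) (A : 'rV[R]_m -> 'M[R]_(r, s))
  (B : 'rV[R]_m -> 'M[R]_(s, t)) z :
  mdiff A z -> mdiff B z -> mdiff (fun w => A w *m B w) z.
Proof.
move=> dA dB i j; under eq_fun do rewrite mxE.
by apply: differentiable_bigsum => k _; apply: differentiable_funM.
Qed.

Lemma mdiffT (r s : nat) (A : 'rV[R]_m -> 'M[R]_(r, s)) z :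
  mdiff A z -> mdiff (fun w => (A w)^T) z.
Proof. by move=> dA i j; under eq_fun do rewrite mxE; apply: dA. Qed.

Lemma dmxM V (r s t : nat) (A : 'rV[R]_m -> 'M[R]_(r, s))
  (B : 'rV[R]_m -> 'M[R]_(s, t)) z : mdiff A z -> mdiff B z ->
  dmx V (fun w => A w *m B w) z = dmx V A z *m B z + A z *m dmx V B z.
Proof.
move=> dA dB; apply/matrixP => i j; rewrite !mxE.
under [X in dir _ X]eq_fun do rewrite mxE.
rewrite dir_sum => [|k _]; last exact: differentiable_funM.
rewrite -big_split; apply: eq_bigr => k _ /=.
by rewrite dirM // !mxE.
Qed.

Lemma dmxT V (r s : nat) (A : 'rV[R]_m -> 'M[R]_(r, s)) z :
  dmx V (fun w => (A w)^T) z = (dmx V A z)^T.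
Proof. by apply/matrixP => i j; rewrite !mxE; under eq_fun do rewrite mxE. Qed.

Lemma dmxD V (r s : nat) (A B : 'rV[R]_m -> 'M[R]_(r, s)) z :
  mdiff A z -> mdiff B z ->
  dmx V (fun w => A w + B w) z = dmx V A z + dmx V B z.
Proof.
move=> dA dB; apply/matrixP => i j; rewrite !mxE.
by under eq_fun do rewrite mxE; rewrite dirD.
Qed.

Lemma near_eq_dmx V (r s : nat) (A B : 'rV[R]_m -> 'M[R]_(r, s)) z :
  (\forall w \near z, A w = B w) -> dmx V A z = dmx V B z.
Proof.
move=> AB; apply/matrixP => i j; rewrite !mxE; apply: near_eq_dir.
by apply: filterS AB => w ->.
Qed.

End Calculus.

Lemma open_near (T : topologicalType) (D : set T) (P : T -> Prop) z :
  open D -> D z -> (forall w, D w -> P w) -> \forall w \near z, P w.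
Proof. by move=> oD Dz DP; apply: filterS DP _; exact: open_nbhs_nbhs. Qed.

Section ChainRule.
Context {R : realType} {m l : nat}.
Implicit Types (f : 'rV[R]_l -> R) (h : 'rV[R]_m -> 'rV[R]_l).

Lemma differentiable_row h z :
  (forall b, differentiable (fun w => h w 0 b) z) -> differentiable h z.
Proof.
move=> dh.
rewrite (_ : h = \sum_(b < l) (fun w => h w 0 b *: (delta_mx 0 b : 'rV[R]_l))).
  by apply: differentiable_sum => b; apply: differentiableZl.
by rewrite funeqE => w; rewrite fct_sumE [LHS]row_sum_delta.
Qed.

Lemma differentiable_row_coord h z b :
  differentiable h z -> differentiable (fun w => h w 0 b) z.
Proof.
move=> dh; apply: (@differentiable_comp _ _ _ _ h (fun u => u 0 b)) => //.
exact: differentiable_coord.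
Qed.

Lemma diff_row_coord h z b v : differentiable h z ->
  'd h z v 0 b = 'd (fun w => h w 0 b) z v.
Proof.
move=> dh; have dc := differentiable_coordr b (h z).
have := @diff_comp _ _ _ _ h (fun u : 'rV[R]_l => u 0 b) _ dh dc.
move=> /(congr1 (@^~ v)) /= E; rewrite [RHS]E.
by rewrite -[RHS]deriveE // derive_coord.
Qed.

Lemma jacobianE h z a b : differentiable h z ->
  ('J h z) a b = pd a (fun w => h w 0 b) z.
Proof.
move=> dh; rewrite mxE diff_row_coord // -pdE //.
exact: differentiable_row_coord.
Qed.

Lemma pd_comp f h z a : differentiable h z -> differentiable f (h z) ->
  pd a (fun w => f (h w)) z =
  \sum_b pd b f (h z) * pd a (fun w => h w 0 b) z.
Proof.
move=> dh df; rewrite pdE; last exact: differentiable_comp.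
have /(congr1 (@^~ (delta_mx 0 a))) -> := diff_comp dh df.
rewrite /= diff_pd //; apply: eq_bigr => b _.
rewrite diff_row_coord // -pdE 1?mulrC //.
exact: differentiable_row_coord.
Qed.

End ChainRule.

(** * Functions of class C^k and smooth functions *)

Section Smooth.
Context {R : realType} {m : nat}.
Implicit Types (f g : 'rV[R]_m -> R) (D U : set 'rV[R]_m).

Lemma Cn_ext k D f g : open D -> (forall z, D z -> f z = g z) ->
  Cn k D f -> Cn k D g.
Proof.
move=> oD; elim: k f g => [|k IH] f g fg.
  move=> cf z Dz; rewrite /prop_for /continuous_at -fg //.
  have E : {near z, f =1 g} by apply: (open_near oD Dz) => w /fg.
  exact: cvg_trans (near_eq_cvg E) (cf z Dz).
move=> [df Cf]; split=> [z Dz|a].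
  apply: near_eq_differentiable (df z Dz).
  by apply: (open_near oD Dz) => w /fg.
apply: IH (Cf a) => z Dz; apply: near_eq_pd.
exact: (open_near oD Dz).
Qed.

Lemma CnS k D f : Cn k.+1 D f -> Cn k D f.
Proof.
elim: k f => [|k IH] f.
  by move=> [df _] z Dz; apply: differentiable_continuous; exact: df.
by move=> [df Cf]; split=> // a; apply: IH; exact: Cf.
Qed.

(** [Cn k U f] involves derivatives of f in the whole space at the points of U, so each point of D
    may bring its own set U. *)
Lemma Cn_local k D f :
  (forall z, D z -> exists U, U z /\ Cn k U f) -> Cn k D f.
Proof.
elim: k f => [|k IH] f /= Df.
  by move=> z /Df [U [Uz]]; exact.
split=> [z /Df [U [Uz [df _]]]|a]; first exact: df.
by apply: IH => z /Df [U [Uz [_ Cf]]]; exists U.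
Qed.

Lemma Cn_subset k D U f : U `<=` D -> Cn k D f -> Cn k U f.
Proof. by move=> UD Cf; apply: Cn_local => z /UD Dz; exists D. Qed.

Lemma Cn_cst k D (c : R) : Cn k D (fun=> c).
Proof.
elim: k c => [|k IH] c; first by move=> z _; exact: cst_continuous.
split=> [z _|a]; first exact: differentiable_cst.
rewrite (_ : pd a _ = fun=> 0) // funeqE => z.
by rewrite pd_dir dir_cst.
Qed.

Lemma Cn_coord k D (a : 'I_m) : Cn k D (fun z => z 0 a).
Proof.
case: k => [|k]; first by move=> z _; exact: coord_continuous.
split=> [z _|b]; first exact: differentiable_coordr.
rewrite (_ : pd b _ = fun=> (b == a)%:R); first exact: Cn_cst.
by rewrite funeqE => z; rewrite pd_coord.
Qed.

Lemma CnD k D f g : open D -> Cn k D f -> Cn k D g -> Cn k D (fun z => f z + g z).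
Proof.
move=> oD; elim: k f g => [|k IH] f g.
  by move=> cf cg z Dz; exact: (cvgD (cf z Dz) (cg z Dz)).
move=> [df Cf] [dg Cg]; split=> [z Dz|a].
  by apply: differentiable_funD; [exact: df|exact: dg].
apply: Cn_ext (IH _ _ (Cf a) (Cg a)) => // z Dz.
by rewrite !pd_dir dirD //; [exact: df|exact: dg].
Qed.

Lemma CnM k D f g : open D -> Cn k D f -> Cn k D g -> Cn k D (fun z => f z * g z).
Proof.
move=> oD; elim: k f g => [|k IH] f g.
  by move=> cf cg z Dz; exact: (cvgM (cf z Dz) (cg z Dz)).
move=> Cf' Cg'; have Cf0 := CnS Cf'; have Cg0 := CnS Cg'.
case: Cf' Cg' => [df Cf] [dg Cg]; split=> [z Dz|a].
  by apply: differentiable_funM; [exact: df|exact: dg].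
have := CnD oD (IH _ _ (Cf a) Cg0) (IH _ _ Cf0 (Cg a)).
apply: Cn_ext => // z Dz.
by rewrite !pd_dir dirM //; [exact: df|exact: dg].
Qed.

Lemma CnV k D f : open D -> (forall z, D z -> f z != 0) -> Cn k D f ->
  Cn k D (fun z => (f z)^-1).
Proof.
move=> oD f0; elim: k f f0 => [|k IH] f f0.
  by move=> cf z Dz; exact: (cvgV (f0 z Dz) (cf z Dz)).
move=> Cf'; have Cf0 := CnS Cf'.
case: Cf' => [df Cf]; split=> [z Dz|a].
  by apply: differentiableV; [exact: df|exact: f0].
have Ci := IH _ f0 Cf0.
have := CnM oD (CnM oD (@Cn_cst k D (-1)) (Cf a)) (CnM oD Ci Ci).
apply: Cn_ext => // z Dz.
by rewrite !pd_dir dirV ?mulN1r ?mulNr //; [exact: df|exact: f0].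
Qed.

Lemma smooth_diff D f z : smooth D f -> D z -> differentiable f z.
Proof. by move=> sf; have [+ _] := sf 1%N; exact. Qed.

Lemma smooth_pd D f a : smooth D f -> smooth D (pd a f).
Proof. by move=> sf k; exact: (sf k.+1).2. Qed.

Lemma smooth_ext D f g : open D -> (forall z, D z -> f z = g z) ->
  smooth D f -> smooth D g.
Proof. by move=> oD fg sf k; exact: Cn_ext (sf k). Qed.

Lemma smooth_subset D U f : U `<=` D -> smooth D f -> smooth U f.
Proof. by move=> UD sf k; exact: Cn_subset (sf k). Qed.

Lemma smooth_local D f :
  (forall z, D z -> exists U, U z /\ smooth U f) -> smooth D f.
Proof.
move=> Df k; apply: Cn_local => z /Df [U [Uz sf]].
by exists U; split=> //; exact: sf.
Qed.

Lemma smooth_cst D (c : R) : smooth D (fun=> c).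
Proof. by move=> k; exact: Cn_cst. Qed.

Lemma smooth_coord D (a : 'I_m) : smooth D (fun z => z 0 a).
Proof. by move=> k; exact: Cn_coord. Qed.

Lemma smoothD D f g : open D -> smooth D f -> smooth D g ->
  smooth D (fun z => f z + g z).
Proof. by move=> oD sf sg k; exact: CnD. Qed.

Lemma smoothM D f g : open D -> smooth D f -> smooth D g ->
  smooth D (fun z => f z * g z).
Proof. by move=> oD sf sg k; exact: CnM. Qed.

Lemma smoothN D f : open D -> smooth D f -> smooth D (fun z => - f z).
Proof.
move=> oD sf; under eq_fun do rewrite -mulN1r.
by apply: smoothM => //; exact: smooth_cst.
Qed.

Lemma smoothB D f g : open D -> smooth D f -> smooth D g ->
  smooth D (fun z => f z - g z).
Proof. by move=> oD sf sg; apply: smoothD => //; exact: smoothN. Qed.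

Lemma smoothV D f : open D -> (forall z, D z -> f z != 0) -> smooth D f ->
  smooth D (fun z => (f z)^-1).
Proof. by move=> oD f0 sf k; exact: CnV. Qed.

Lemma smooth_sum D (I : Type) (r : seq I) (P : pred I) (F : I -> 'rV[R]_m -> R) :
  open D -> (forall i, P i -> smooth D (F i)) ->
  smooth D (fun z => \sum_(i <- r | P i) F i z).
Proof.
move=> oD sF; elim: r => [|i r IH].
  by under eq_fun do rewrite big_nil; exact: smooth_cst.
under eq_fun do rewrite big_cons.
by case Pi: (P i) => //; apply: smoothD => //; exact: sF.
Qed.

Lemma smooth_prod D (I : Type) (r : seq I) (P : pred I) (F : I -> 'rV[R]_m -> R) :
  open D -> (forall i, P i -> smooth D (F i)) ->
  smooth D (fun z => \prod_(i <- r | P i) F i z).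
Proof.
move=> oD sF; elim: r => [|i r IH].
  by under eq_fun do rewrite big_nil; exact: smooth_cst.
under eq_fun do rewrite big_cons.
by case Pi: (P i) => //; apply: smoothM => //; exact: sF.
Qed.

Definition smooth_mx (r s : nat) D (A : 'rV[R]_m -> 'M[R]_(r, s)) :=
  forall i j, smooth D (fun z => A z i j).

Lemma smooth_mx_diff (r s : nat) D (A : 'rV[R]_m -> 'M[R]_(r, s)) z :
  smooth_mx D A -> D z -> mdiff A z.
Proof. by move=> sA Dz i j; exact: smooth_diff (sA i j) Dz. Qed.

Lemma smooth_mulmx (r s t : nat) D (A : 'rV[R]_m -> 'M[R]_(r, s))
    (B : 'rV[R]_m -> 'M[R]_(s, t)) : open D ->
  smooth_mx D A -> smooth_mx D B -> smooth_mx D (fun z => A z *m B z).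
Proof.
move=> oD sA sB i j; under eq_fun do rewrite mxE.
by apply: smooth_sum => // k _; exact: smoothM.
Qed.

Lemma smooth_tr (r s : nat) D (A : 'rV[R]_m -> 'M[R]_(r, s)) :
  smooth_mx D A -> smooth_mx D (fun z => (A z)^T).
Proof. by move=> sA i j; under eq_fun do rewrite mxE; exact: sA. Qed.

Lemma smooth_det (r : nat) D (A : 'rV[R]_m -> 'M[R]_r) : open D ->
  smooth_mx D A -> smooth D (fun z => \det (A z)).
Proof.
move=> oD sA; apply: smooth_sum => // s _; apply: smoothM => //.
  exact: smooth_cst.
by apply: smooth_prod => // i _; exact: sA.
Qed.

(** Cramer's rule: the entries of the inverse are polynomials in the entries divided by a
    nonvanishing determinant. *)
Lemma smooth_invmx (r : nat) D (A : 'rV[R]_m -> 'M[R]_r) : open D ->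
  (forall z, D z -> A z \in unitmx) ->
  smooth_mx D A -> smooth_mx D (fun z => invmx (A z)).
Proof.
move=> oD uA sA i j.
apply: (@smooth_ext D (fun z => (\det (A z))^-1 * cofactor (A z) j i)) => //.
  by move=> z Dz; rewrite /invmx uA // !mxE.
apply: smoothM => //.
  apply: smoothV => //; last exact: smooth_det.
  by move=> z /uA; rewrite unitmxE unitfE.
apply: smoothM => //; first exact: smooth_cst.
apply: smooth_det => // a b; under eq_fun do rewrite !mxE.
exact: sA.
Qed.

End Smooth.

(** Induction on k for all f at once, with h fixed: by the chain rule a partial derivative of the
    composite is a sum of products of a derivative of f composed with h and a derivative of h. *)
Lemma Cn_comp (R : realType) (m l k : nat) (D : set 'rV[R]_m) (E : set 'rV[R]_l)
    (f : 'rV[R]_l -> R) (h : 'rV[R]_m -> 'rV[R]_l) :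
  open D -> (forall z, D z -> E (h z)) -> smooth_map D h -> Cn k E f ->
  Cn k D (fun z => f (h z)).
Proof.
move=> oD DE sh.
have dh z : D z -> differentiable h z.
  by move=> Dz; apply: differentiable_row => b; exact: smooth_diff (sh b) Dz.
elim: k f => [|k IH] f.
  move=> cf z Dz; apply: continuous_comp; last exact: cf (DE _ Dz).
  exact: differentiable_continuous (dh z Dz).
move=> [df Cf]; split=> [z Dz|a].
  by apply: differentiable_comp; [exact: dh|exact: df (DE _ Dz)].
apply: (@Cn_ext _ _ _ _ (fun z => \sum_b pd b f (h z) * pd a (fun w => h w 0 b) z)) => //.
  by move=> z Dz; rewrite pd_comp //; [exact: dh|exact: df (DE _ Dz)].
elim: (index_enum _) => [|b r IHr].
  by under eq_fun do rewrite big_nil; exact: Cn_cst.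
under eq_fun do rewrite big_cons.
apply: CnD => //; apply: CnM => //; first exact: IH (Cf b).
exact: smooth_pd (sh b) k.
Qed.

Lemma smooth_comp (R : realType) (m l : nat) (D : set 'rV[R]_m) (E : set 'rV[R]_l)
    (f : 'rV[R]_l -> R) (h : 'rV[R]_m -> 'rV[R]_l) :
  open D -> (forall z, D z -> E (h z)) -> smooth_map D h -> smooth E f ->
  smooth D (fun z => f (h z)).
Proof. by move=> oD DE sh sf k; exact: Cn_comp DE sh (sf k). Qed.

(** * Symmetry of second partial derivatives *)

Section Schwarz.
Context {R : realType} {m : nat}.
Implicit Types (f g : 'rV[R]_m -> R) (D : set 'rV[R]_m).

Lemma pd_translate a f (c z : 'rV[R]_m) :
  pd a (fun w => f (w + c)) z = pd a f (z + c).
Proof.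
by rewrite /pd /derive /=; under eq_fun do rewrite -addrA.
Qed.

Lemma MVT_line a g (w : 'rV[R]_m) (t : R) : 0 <= t ->
  (forall s, 0 <= s <= t -> differentiable g (s *: delta_mx 0 a + w)) ->
  exists2 s, 0 <= s <= t &
    g (t *: delta_mx 0 a + w) - g w = pd a g (s *: delta_mx 0 a + w) * t.
Proof.
move=> t0 dg; set e := delta_mx 0 a.
pose phi (s : R) := g (s *: e + w).
have dphi s : 0 <= s <= t -> is_derive s (1 : R) phi (pd a g (s *: e + w)).
  move=> st.
  have E : (fun h : R => h^-1 *: ((phi \o shift s) (h *: (1 : R)) - phi s)) =
           (fun h : R => h^-1 *: ((g \o shift (s *: e + w)) (h *: e) - g (s *: e + w))).
    rewrite funeqE => h /=; rewrite /phi; congr (_ *: (g _ - _)).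
    by rewrite [h *: 1]mulr1 scalerDl addrA.
  have dr : derivable g (s *: e + w) e by apply: diff_derivable; exact: dg.
  by apply: DeriveDef; [rewrite /derivable E|rewrite /derive E].
have [||s] := @MVT_segment R phi (fun s => pd a g (s *: e + w)) 0 t t0.
- move=> s; rewrite in_itv /= => /andP[s0 st].
  by apply: dphi; rewrite !ltW.
- apply: derivable_within_continuous => s; rewrite in_itv /= => st.
  by have [] := dphi s st.
by rewrite in_itv /= /phi scale0r add0r subr0 => st E; exists s.
Qed.

(** Mean value theorem along a for the increment w |-> f (w + t e_b) - f w, then along b for the
    derivative of f in direction a. The left side is symmetric in a and b, which is what [pdC]
    exploits. *)
Lemma second_difference D f a b (z : 'rV[R]_m) (t : R) : 0 <= t -> smooth D f ->
  (forall s s', 0 <= s <= t -> 0 <= s' <= t ->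
     D (s' *: delta_mx 0 b + (s *: delta_mx 0 a + z))) ->
  exists s s', [/\ 0 <= s <= t, 0 <= s' <= t &
    f (t *: delta_mx 0 b + (t *: delta_mx 0 a + z)) - f (t *: delta_mx 0 a + z)
    - (f (t *: delta_mx 0 b + z) - f z) =
    pd b (pd a f) (s' *: delta_mx 0 b + (s *: delta_mx 0 a + z)) * t * t].
Proof.
move=> t0 sf DD; set ea := delta_mx 0 a; set eb := delta_mx 0 b.
have tt : 0 <= t <= t by rewrite t0 lexx.
have D0 s : 0 <= s <= t -> D (s *: ea + z).
  by move=> st; rewrite -[X in D X]add0r -(scale0r eb); apply: DD; rewrite ?lexx.
have df w : D w -> differentiable f w by exact: smooth_diff.
have dft s : 0 <= s <= t -> differentiable (fun w => f (w + t *: eb)) (s *: ea + z).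
  move=> st; apply: (@differentiable_comp _ _ _ _ (fun w => w + t *: eb) f).
    by apply: differentiableD; [by []|exact: differentiable_cst].
  by apply: df; rewrite addrC; exact: DD.
have [s st Es] := @MVT_line a (fun w => f (w + t *: eb) - f w) z t t0
   (fun s st => differentiableB (dft s st) (df _ (D0 s st))).
have sfa := smooth_pd a sf.
have [s' s't Es'] := @MVT_line b (pd a f) (s *: ea + z) t t0
   (fun s' st' => smooth_diff sfa (DD s s' st st')).
exists s, s'; split=> //.
rewrite -Es' !(addrC (t *: eb)) {}Es; congr (_ * _).
rewrite pd_dir dirB -?pd_dir ?pd_translate //; first exact: dft.
exact/df/D0.
Qed.

Lemma lt_dist2 (u v x y eps : R) : x = y -> `|u - x| < eps -> `|v - y| < eps ->
  `|u - v| < eps + eps.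
Proof.
move=> -> H1 H2; rewrite (_ : u - v = (u - y) - (v - y)); last by ring.
by apply: le_lt_trans (ler_normB _ _) _; exact: ltrD.
Qed.

Lemma common_ball D (G H : 'rV[R]_m -> R) (z : 'rV[R]_m) (eps : R) :
  open D -> D z -> {for z, continuous G} -> {for z, continuous H} -> 0 < eps ->
  exists2 e, 0 < e & forall w, ball z e w ->
    [/\ D w, `|G z - G w| < eps & `|H z - H w| < eps].
Proof.
move=> oD Dz cG cH eps0.
have : \forall w \near z, [/\ D w, `|G z - G w| < eps & `|H z - H w| < eps].
  near=> w; split.
  - by near: w; exact: open_nbhs_nbhs.
  - by near: w; move/cvgrPdist_lt : cG; exact.
  - by near: w; move/cvgrPdist_lt : cH; exact.
by move=> /nbhs_ballP [e /= e0 He]; exists e.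
Unshelve. all: by end_near. Qed.

(** The second difference, taken in both orders and divided by t^2, gives two points near z at which
    the mixed derivatives have a common value; by continuity each value at z is within [eps], half
    of the supposed gap, of it. *)
Lemma pdC D f a b (z : 'rV[R]_m) : open D -> smooth D f -> D z ->
  pd a (pd b f) z = pd b (pd a f) z.
Proof.
move=> oD sf Dz; apply/eqP; apply: contraT => neq.
set ea : 'rV[R]_m := delta_mx 0 a; set eb : 'rV[R]_m := delta_mx 0 b.
pose eps := `|pd a (pd b f) z - pd b (pd a f) z| / 2.
have eps0 : 0 < eps by rewrite divr_gt0 // normr_gt0 subr_eq0.
have cab : {for z, continuous (pd a (pd b f))}.
  exact: (smooth_pd a (smooth_pd b sf) 0%N).
have cba : {for z, continuous (pd b (pd a f))}.
  exact: (smooth_pd b (smooth_pd a sf) 0%N).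
have [e e0 He] := common_ball oD Dz cab cba eps0.
(* The summand 1 makes c positive and keeps the rectangle of side t = e / c strictly inside the ball
   of radius e. *)
pose c := `|ea| + `|eb| + 1.
have c0 : 0 < c by rewrite ltr_wpDl // addr_ge0.
pose t := e / c.
have t0 : 0 < t by rewrite divr_gt0.
have B s s' : 0 <= s <= t -> 0 <= s' <= t -> ball z e (s' *: eb + (s *: ea + z)).
  move=> /andP[s0 st] /andP[s0' st']; rewrite -ball_normE /ball_ /=.
  rewrite addrA opprD addrCA subrr addr0 normrN.
  apply: (@le_lt_trans _ _ (t * `|eb| + t * `|ea|)).
    apply: le_trans (ler_normD _ _) _; rewrite !normrZ !ger0_norm //.
    by apply: lerD; apply: ler_wpM2r.
  rewrite -mulrDr -[X in _ < X](divfK (lt0r_neq0 c0)) -/t ltr_pM2l //.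
  by rewrite [X in X < _]addrC ltrDl ltr01.
have B1 s s' st st' := let: And3 Dw _ _ := He _ (B s s' st st') in Dw.
have B' s s' : 0 <= s <= t -> 0 <= s' <= t -> ball z e (s' *: ea + (s *: eb + z)).
  by move=> st st'; rewrite addrCA; exact: B.
have B2 s s' st st' := let: And3 Dw _ _ := He _ (B' s s' st st') in Dw.
have [s1 [s1' [s1t s1t' E1]]] := second_difference (ltW t0) sf B1.
have [s2 [s2' [s2t s2t' E2]]] := second_difference (ltW t0) sf B2.
have EE : f (t *: eb + (t *: ea + z)) - f (t *: ea + z) - (f (t *: eb + z) - f z) =
          f (t *: ea + (t *: eb + z)) - f (t *: eb + z) - (f (t *: ea + z) - f z).
  by rewrite (addrCA (t *: ea)); ring.
have tn0 := lt0r_neq0 t0.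
have E12 := mulIf tn0 (mulIf tn0 (etrans (esym E1) (etrans EE E2))).
have [_ _ H1] := He _ (B _ _ s1t s1t').
have [_ H2 _] := He _ (B' _ _ s2t s2t').
have := lt_dist2 (esym E12) H2 H1.
by rewrite -splitr ltxx.
Qed.

End Schwarz.

(** * Matrix identities and derivatives in induced coordinates *)

Lemma addmxE (V : nmodType) (r s : nat) (A B : 'M[V]_(r, s)) i j :
  (A + B) i j = A i j + B i j.
Proof. by rewrite mxE. Qed.

Lemma oppmxE (V : zmodType) (r s : nat) (A : 'M[V]_(r, s)) i j : (- A) i j = - A i j.
Proof. by rewrite mxE. Qed.

Lemma scalemxE (R : pzRingType) (r s : nat) (c : R) (A : 'M[R]_(r, s)) i j :
  (c *: A) i j = c * A i j.
Proof. by rewrite mxE. Qed.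

Lemma trmxD (V : nmodType) (r s : nat) (A B : 'M[V]_(r, s)) : (A + B)^T = A^T + B^T.
Proof. by apply/matrixP => i j; rewrite !mxE. Qed.

Lemma trmxN (V : zmodType) (r s : nat) (A : 'M[V]_(r, s)) : (- A)^T = - A^T.
Proof. by apply/matrixP => i j; rewrite !mxE. Qed.

Definition mxlinE := (addmxE, oppmxE, scalemxE).

Definition fiber_scale (R : realType) (n : nat) (t : R) (z : 'rV[R]_(n + n)) : 'rV[R]_(n + n) :=
  row_mx (lsubmx z) (t *: rsubmx z).

Lemma near_cst_derive (R : realType) (m : nat) (f : 'rV[R]_m -> R) (z v : 'rV[R]_m) (l : R) :
  (\forall h \near (0 : R)^', f (h *: v + z) - f z = h * l) -> 'D_v f z = l.
Proof.
move=> E; apply: cvg_lim => //; apply: cvg_near_cst; near=> h.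
rewrite /= (near E h) // [_ *: _]mulrA mulVf ?mul1r //.
by near: h; exact: nbhs_dnbhs_neq.
Unshelve. all: by end_near. Qed.

(** This is L_xi G at a point in adapted components: h, k are the horizontal and v, w the vertical
    parts of X and Y, primes are derivatives along [xi], A stands for [dlm Pup] and C for the
    curvature [Rmx]. The terms in A from the derivatives of g and G cancel those from the brackets,
    and only mixed terms remain. *)
Lemma lie_metric_algebra (R : comPzRingType) (n : nat) (h k v w h' k' v' w' : 'rV[R]_n)
    (G g A C : 'M[R]_n) :
  G *m g = 1%:M -> g *m G = 1%:M -> G^T = G -> g^T = g -> C^T = C ->
  (h' *m g + h *m - (A *m g + g *m A^T)) *m k^T + h *m g *m k'^T +
  ((v' *m G + v *m (G *m A + A^T *m G)) *m w^T + v *m G *m w'^T) -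
  ((h' - h *m A - v *m G) *m g *m k^T +
   (v' - h *m C + v *m A^T) *m G *m w^T) -
  (h *m g *m (k' - k *m A - w *m G)^T +
   v *m G *m (w' - k *m C + w *m A^T)^T) =
  h *m (1%:M + C *m G) *m w^T + k *m (1%:M + C *m G) *m v^T.
Proof.
move=> Gg gG Gs gs Cs.
(* A 1 x 1 matrix equals its transpose. *)
have -> : k *m (1%:M + C *m G) *m v^T = v *m (1%:M + G *m C) *m k^T.
  rewrite [LHS](_ : _ = (k *m (1%:M + C *m G) *m v^T)^T); last first.
    by rewrite [X in X = _]mx11_scalar [X in _ = X^T]mx11_scalar tr_scalar_mx.
  by rewrite !trmx_mul trmxD trmx_mul trmxK trmx1 Gs Cs mulmxA.
rewrite !(trmxD, trmxN) !trmx_mul trmxK Gs Cs.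
rewrite !(mulmxDl, mulmxDr, mulmxN, mulNmx, mulmxA, opprD, opprK).
rewrite -[v *m G *m g]mulmxA Gg -[h *m g *m G]mulmxA gG !mulmx1.
by apply/matrixP => i j; rewrite !mxlinE; ring.
Qed.

(** The direction of derivation is the row index, so that a derivative along V is a left
    multiplication by the row vector V. *)
Definition dxm (R : realType) (n s : nat) (A : 'rV[R]_(n + n) -> 'rV[R]_s) z : 'M[R]_(n, s) :=
  \matrix_(i, k) pdx i (fun w => A w 0 k) z.

Definition dpm (R : realType) (n s : nat) (A : 'rV[R]_(n + n) -> 'rV[R]_s) z : 'M[R]_(n, s) :=
  \matrix_(i, k) pdp i (fun w => A w 0 k) z.

Lemma dmx_split (R : realType) (n s : nat) (A : 'rV[R]_(n + n) -> 'rV[R]_s) V z :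
  dmx V A z = lsubmx (V z) *m dxm A z + rsubmx (V z) *m dpm A z.
Proof.
apply/matrixP => i j; rewrite ord1 addmxE [LHS]mxE /dir big_split_ord /=.
rewrite [X in _ = X + _]mxE [X in _ = _ + X]mxE.
congr (_ + _); apply: eq_bigr => k _.
  by rewrite [lsubmx _ _ _]mxE [dxm _ _ _ _]mxE.
by rewrite [rsubmx _ _ _]mxE [dpm _ _ _ _]mxE.
Qed.

Lemma innerE (R : realType) (m : nat) (gm : 'rV[R]_m -> 'M[R]_m) X Y z :
  inner gm X Y z = (X z *m gm z *m (Y z)^T) 0 0.
Proof.
rewrite /inner mxE exchange_big; apply: eq_bigr => b _.
rewrite [(X z *m _) 0 b]mxE [(Y z)^T _ _]mxE mulr_suml; apply: eq_bigr => a _.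
by rewrite [gm z a b * _]mulrC.
Qed.

Lemma lie_bracketE (R : realType) (m : nat) (X Y : 'rV[R]_m -> 'rV[R]_m) z :
  lie_bracket X Y z = dmx X Y z - dmx Y X z.
Proof. by apply/matrixP => i j; rewrite ord1 !mxE. Qed.

(** * The Levi-Civita connection in matrix form *)

Section LeviCivita.
Context {R : realType} {m : nat} {gm : 'rV[R]_m -> 'M[R]_m} {z : 'rV[R]_m}.
Hypothesis gs : \forall w \near z, (gm w)^T = gm w.
Hypothesis gu : gm z \in unitmx.
Hypothesis dg : mdiff gm z.
Implicit Types X Y V : 'rV[R]_m -> 'rV[R]_m.

(** The connection form evaluated on X, with its indices placed so that it acts on row vectors from
    the right. *)
Definition connection_mx X : 'M[R]_m :=
  \matrix_(d, b) \sum_a christoffel gm b a d z * X z 0 a.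

Lemma nablaE X Y : nabla gm X Y z = dmx X Y z + Y z *m connection_mx X.
Proof.
apply/matrixP => i b; rewrite ord1 addmxE !mxE; congr (_ + _).
rewrite exchange_big; apply: eq_bigr => d _; rewrite mxE mulr_sumr.
by apply: eq_bigr => a _; rewrite [RHS]mulrC.
Qed.

Lemma nabla_torsion_free X Y : nabla gm X Y z - nabla gm Y X z = lie_bracket X Y z.
Proof.
rewrite !nablaE lie_bracketE.
suff -> : X z *m connection_mx Y = Y z *m connection_mx X.
  by rewrite opprD addrACA subrr addr0.
apply/matrixP => i b; rewrite ord1 !mxE.
under eq_bigr do rewrite mxE mulr_sumr.
rewrite exchange_big; apply: eq_bigr => d _; rewrite mxE mulr_sumr.
apply: eq_bigr => a _; rewrite christoffel_torsion_free //; ring.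
Qed.

Lemma dmx_metric X : dmx X gm z =
  connection_mx X *m gm z + gm z *m (connection_mx X)^T.
Proof.
apply/matrixP => a b; rewrite addmxE !mxE /dir.
under eq_bigr => d _ do rewrite christoffel_metric // mulrDr !mulr_sumr.
rewrite big_split /= exchange_big [X in _ + X]exchange_big /=.
congr (_ + _); apply: eq_bigr => e _; rewrite !mxE ?mulr_suml ?mulr_sumr;
  by apply: eq_bigr => d _; ring.
Qed.

Lemma dir_inner X Y V : mdiff Y z -> mdiff V z ->
  dir X (inner gm Y V) z = inner gm (nabla gm X Y) V z + inner gm Y (nabla gm X V) z.
Proof.
move=> dY dV.
have -> : dir X (inner gm Y V) z = dmx X (fun w => Y w *m gm w *m (V w)^T) z 0 0.
  by rewrite mxE; congr dir; rewrite funeqE => w; exact: innerE.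
rewrite !innerE -addmxE; congr (fun_of_matrix _ 0 0).
rewrite dmxM; [|exact: mdiffM|exact: mdiffT].
rewrite dmxM // dmxT dmx_metric !nablaE trmxD trmx_mul.
move: (dmx X Y z) (dmx X V z) (connection_mx X) => dY' dV' C.
rewrite !(mulmxDl, mulmxDr, mulmxA).
by rewrite !addrA [LHS]addrAC.
Qed.

(** Metricity moves the covariant derivatives from X and Y to V; the resulting terms g(nabla_X V, Y)
    + g(X, nabla_Y V) are (L_V g)(X, Y) because the torsion vanishes. *)
Lemma inner_nabla_sym X Y V : mdiff X z -> mdiff Y z -> mdiff V z ->
  inner gm (nabla gm X Y) V z + inner gm (nabla gm Y X) V z =
  dir X (inner gm Y V) z + dir Y (inner gm X V) z - lie_metric gm V X Y z.
Proof.
move=> dX dY dV.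
have innerB U W Z : inner gm (fun w => U w - W w) Z z = inner gm U Z z - inner gm W Z z.
  by rewrite !innerE !mulmxBl !mxlinE.
have innerBr U W Z : inner gm Z (fun w => U w - W w) z = inner gm Z U z - inner gm Z W z.
  by rewrite !innerE trmxD trmxN mulmxDr mulmxN !mxlinE.
have innerC U W : inner gm U W z = inner gm W U z.
  have tr1 (A : 'M[R]_1) : A 0 0 = A^T 0 0 by rewrite mxE.
  by rewrite !innerE [LHS]tr1 !trmx_mul trmxK (nbhs_singleton gs) mulmxA.
have bl U W : inner gm (lie_bracket V U) W z =
    inner gm (nabla gm V U) W z - inner gm (nabla gm U V) W z.
  by rewrite -innerB !innerE nabla_torsion_free.
rewrite !dir_inner // /lie_metric dir_inner // bl.
rewrite [inner gm X (lie_bracket V Y) z]innerC bl.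
rewrite (innerC X (nabla _ _ _)) (innerC Y (nabla _ _ _)) (innerC X (nabla _ _ _)).
by ring.
Qed.

End LeviCivita.

(** * Dilations of the fibres and Cartan functions in one chart *)

Lemma derive_lin_comp (R : realType) (m l : nat) (f : 'rV[R]_l -> R)
    (L : {linear 'rV[R]_m -> 'rV[R]_l}) (v z : 'rV[R]_m) :
  'D_v (fun w => f (L w)) z = 'D_(L v) f (L z).
Proof.
have E (h : R) : L (h *: v + z) = h *: L v + L z by rewrite linearP.
by rewrite /derive; under eq_fun do rewrite /= E.
Qed.

Lemma fiber_scale_is_linear (R : realType) (n : nat) (t : R) :
  linear (@fiber_scale R n t).
Proof.
move=> a u v; rewrite /fiber_scale !linearP /= scale_row_mx add_row_mx.
by rewrite !scalerA mulrC.
Qed.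

HB.instance Definition _ (R : realType) (n : nat) (t : R) :=
  GRing.isLinear.Build R 'rV[R]_(n + n) 'rV[R]_(n + n) _ (@fiber_scale R n t)
    (@fiber_scale_is_linear R n t).

Lemma fiber_scale_base (R : realType) (n : nat) (t : R) (i : 'I_n) :
  fiber_scale t (delta_mx 0 (lshift n i)) = delta_mx 0 (lshift n i) :> 'rV[R]_(n + n).
Proof.
apply/matrixP => r c; rewrite ord1 /fiber_scale.
case: (split_ordP c) => k ->; rewrite ?row_mxEl ?row_mxEr !mxE //.
by rewrite eq_rlshift mulr0.
Qed.

Lemma fiber_scale_fiber (R : realType) (n : nat) (t : R) (i : 'I_n) :
  fiber_scale t (delta_mx 0 (rshift n i)) = t *: delta_mx 0 (rshift n i) :> 'rV[R]_(n + n).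
Proof.
apply/matrixP => r c; rewrite ord1 /fiber_scale.
case: (split_ordP c) => k ->; rewrite ?row_mxEl ?row_mxEr !mxE //.
by rewrite eq_lrshift mulr0.
Qed.

(** The data of a Cartan space in a single chart, on an open set stable under positive dilations of
    the fibres; the pointwise computations take place here. *)
Record cartan_function (R : realType) (n : nat) (D : set 'rV[R]_(n + n))
    (K : 'rV[R]_(n + n) -> R) : Prop := CartanFunction {
  cf_open : open D;
  cf_conic : forall z t, D z -> 0 < t -> D (fiber_scale t z);
  cf_smooth : smooth D K;
  cf_gt0 : forall z, D z -> 0 < K z;
  cf_homogeneous : forall z t, D z -> 0 < t -> K (fiber_scale t z) = t * K z;
  cf_posdef : forall z (v : 'rV[R]_n), D z -> v != 0 ->
    0 < \sum_i \sum_j gup K z i j * v 0 i * v 0 j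
}.

Section LocalCartan.

(* Comparing iterated partial derivatives up to conversion does not terminate in
   practice. *)
#[local] Opaque pd derive.

Context {R : realType} {n : nat}.
Variables (D : set 'rV[R]_(n + n)) (K : 'rV[R]_(n + n) -> R).
Hypothesis cfK : cartan_function D K.

Let oD : open D := cf_open cfK.
Let homD := cf_conic cfK.
Let sK : smooth D K := cf_smooth cfK.
Let K_gt0 := cf_gt0 cfK.
Let homK := cf_homogeneous cfK.
Let posK := cf_posdef cfK.

Implicit Types (z w : 'rV[R]_(n + n)) (f : 'rV[R]_(n + n) -> R).
Local Notation F := (Ksq K).
Local Notation Gup := (gup K).
Local Notation Glo := (glo K).

Lemma near_eq_dom (T : Type) (f g : 'rV[R]_(n + n) -> T) z :
  D z -> (forall w, D w -> f w = g w) -> \forall w \near z, f w = g w.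
Proof. by move=> Dz fg; apply: open_near fg. Qed.

Lemma Ksq_smooth : smooth D F.
Proof. exact: smoothM. Qed.

Lemma Ksq_gt0 z : D z -> 0 < F z.
Proof. by move=> /K_gt0 Kz; rewrite exprn_gt0. Qed.

Lemma pdx_smooth f i : smooth D f -> smooth D (pdx i f).
Proof. exact: smooth_pd. Qed.

Lemma pdp_smooth f i : smooth D f -> smooth D (pdp i f).
Proof. exact: smooth_pd. Qed.

Lemma pdpC f i j z : smooth D f -> D z -> pdp i (pdp j f) z = pdp j (pdp i f) z.
Proof. exact: pdC. Qed.

Lemma pdxpC f i j z : smooth D f -> D z -> pdx i (pdp j f) z = pdp j (pdx i f) z.
Proof. exact: pdC. Qed.

Lemma pdxC f i j z : smooth D f -> D z -> pdx i (pdx j f) z = pdx j (pdx i f) z.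
Proof. exact: pdC. Qed.

Lemma gup_smooth : smooth_mx D Gup.
Proof.
move=> i j; under eq_fun do rewrite mxE.
apply: smoothM => //; first exact: smooth_cst.
by do 2!apply: pdp_smooth; exact: Ksq_smooth.
Qed.

Lemma gup_sym z : D z -> (Gup z)^T = Gup z.
Proof.
move=> Dz; apply/matrixP => i j; rewrite !mxE.
by rewrite (pdpC _ _ Ksq_smooth Dz).
Qed.

(** A nonzero row vector v in the kernel would have v g v^T = 0, against positive definiteness. *)
Lemma gup_unit z : D z -> Gup z \in unitmx.
Proof.
move=> Dz; rewrite -row_free_unit -kermx_eq0; apply/eqP/row_matrixP => r.
rewrite row0; apply/eqP; apply: contraT => v0.
have := posK Dz v0; set v := row r _.
have vG : v *m Gup z = 0 by rewrite -row_mul mulmx_ker row0.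
rewrite (_ : \sum_i _ = 0) ?ltxx //.
transitivity ((v *m Gup z *m v^T) 0 0); last by rewrite vG mul0mx mxE.
rewrite mxE exchange_big; apply: eq_bigr => j _.
rewrite [(v *m _) 0 j]mxE mulr_suml; apply: eq_bigr => i _.
by rewrite [v^T j 0]mxE [v 0 i * _]mulrC.
Qed.

Lemma glo_smooth : smooth_mx D Glo.
Proof. by apply: smooth_invmx => //; [exact: gup_unit|exact: gup_smooth]. Qed.

Lemma glo_sym z : D z -> (Glo z)^T = Glo z.
Proof. by move=> Dz; rewrite /glo trmx_inv gup_sym. Qed.

Lemma gupK z : D z -> Gup z *m Glo z = 1%:M.
Proof. by move=> /gup_unit; exact: mulmxV. Qed.

Lemma gloK z : D z -> Glo z *m Gup z = 1%:M.
Proof. by move=> /gup_unit; exact: mulVmx. Qed.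

Lemma Ncoef_smooth i j : smooth D (Ncoef K i j).
Proof.
have sF := Ksq_smooth; have sG := glo_smooth.
apply: (smoothB oD); (apply: (smoothM oD); first exact: smooth_cst).
  apply: (smooth_sum _ oD) => k _; apply: (smoothB oD); apply: (smoothM oD).
  - by apply: pdp_smooth; exact: sG.
  - exact: pdx_smooth.
  - exact: pdp_smooth.
  - by apply: pdx_smooth; exact: sG.
apply: (smooth_sum _ oD) => k _; apply: (smoothD oD); apply: (smoothM oD).
- exact: sG.
- by apply: pdp_smooth; exact: pdx_smooth.
- exact: sG.
- by apply: pdp_smooth; exact: pdx_smooth.
Qed.

Lemma pdx_momentum k i z : pdx k (fun w => momentum w i) z = 0.
Proof.
rewrite /momentum; under eq_fun do rewrite mxE.
by rewrite /pdx pd_coord eq_lrshift.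
Qed.

Lemma pdp_momentum k i z : pdp k (fun w => momentum w i) z = (k == i)%:R.
Proof.
rewrite /momentum; under eq_fun do rewrite mxE.
by rewrite /pdp pd_coord eq_rshift.
Qed.

Lemma dir_split V f z : dir V f z =
  \sum_i V z 0 (lshift n i) * pdx i f z + \sum_i V z 0 (rshift n i) * pdp i f z.
Proof. by rewrite /dir big_split_ord. Qed.

(** * Euler's relations for K^2 and its derivatives *)

(** In the direction (0, p) the function K is affine, being multiplied by 1 + h for small h, so its
    difference quotient is constant. *)
Lemma euler_K z : D z -> \sum_i momentum z i * pdp i K z = K z.
Proof.
move=> Dz; pose v : 'rV[R]_(n + n) := row_mx 0 (rsubmx z).
have -> : \sum_i momentum z i * pdp i K z = dir (fun=> v) K z.
  rewrite dir_split [X in _ = X + _]big1 => [|i _]; last first.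
    by rewrite /v row_mxEl mxE mul0r.
  by rewrite add0r; apply: eq_bigr => i _; rewrite /v row_mxEr.
rewrite dirE -?deriveE; try exact: smooth_diff sK Dz.
apply: near_cst_derive; near=> h.
have -> : h *: v + z = fiber_scale (1 + h) z.
  rewrite /fiber_scale /v -[X in _ + X](hsubmxK z) scale_row_mx scaler0 add_row_mx add0r.
  by rewrite scalerDl scale1r [X in row_mx _ X]addrC.
rewrite homK // ?mulrDl ?mul1r 1?addrC ?addKr //.
have : `|h| < 1 by near: h; exact: dnbhs0_lt.
by rewrite ltr_norml => /andP[h1 _]; rewrite -ltrBlDr sub0r.
Unshelve. all: by end_near. Qed.

Lemma pd_Ksq a z : D z -> pd a F z = 2 * K z * pd a K z.
Proof.
move=> Dz; have dK := smooth_diff sK Dz.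
by rewrite !pd_dir dirM //; ring.
Qed.

Lemma euler_Ksq z : D z -> \sum_i momentum z i * pdp i F z = 2 * F z.
Proof.
move=> Dz; transitivity (2 * K z * \sum_i momentum z i * pdp i K z).
  rewrite mulr_sumr; apply: eq_bigr => i _.
  by rewrite /pdp pd_Ksq //; ring.
by rewrite euler_K // /Ksq; ring.
Qed.

(** Derivative of [euler_Ksq] in p_j; the derivative of the factor p_j itself lowers the coefficient
    from 2 to 1. *)
Lemma euler_dpF j z : D z -> \sum_i momentum z i * pdp i (pdp j F) z = pdp j F z.
Proof.
move=> Dz.
have dF i w : D w -> differentiable (pdp i F) w.
  exact: smooth_diff (pdp_smooth i Ksq_smooth).
have dm i w : differentiable (fun u => momentum u i) w.
  by rewrite /momentum; under eq_fun do rewrite mxE; exact: differentiable_coordr.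
have E : pdp j (fun w => \sum_i momentum w i * pdp i F w) z = 2 * pdp j F z.
  rewrite /pdp (near_eq_pd _ (near_eq_dom Dz euler_Ksq)) !pd_dir dirZ //.
  exact: smooth_diff Ksq_smooth Dz.
move: E; rewrite /pdp pd_dir dir_sum; last first.
  by move=> i _; apply: differentiable_funM => //; exact: dF.
under eq_bigr => i _.
  rewrite dirM //; last exact: dF.
  rewrite -!pd_dir -/(pdp j (fun w => momentum w i) z) pdp_momentum.
  rewrite -/(pdp i (pdp j F) z) -/(pdp j (pdp i F) z) (pdpC j _ Ksq_smooth Dz).
  over.
rewrite big_split /= (bigD1 j) //= eqxx mul1r big1 => [|i /negPf ij]; last first.
  by rewrite eq_sym ij mul0r.
rewrite addr0 mulrDl mul1r => /addrI; exact.
Qed.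

Lemma euler_dxF j z : D z -> \sum_i momentum z i * pdp i (pdx j F) z = 2 * pdx j F z.
Proof.
move=> Dz.
have dF i w : D w -> differentiable (pdp i F) w.
  exact: smooth_diff (pdp_smooth i Ksq_smooth).
have dm i w : differentiable (fun u => momentum u i) w.
  by rewrite /momentum; under eq_fun do rewrite mxE; exact: differentiable_coordr.
have E : pdx j (fun w => \sum_i momentum w i * pdp i F w) z = 2 * pdx j F z.
  rewrite /pdx (near_eq_pd _ (near_eq_dom Dz euler_Ksq)) !pd_dir dirZ //.
  exact: smooth_diff Ksq_smooth Dz.
rewrite -E /pdx pd_dir dir_sum; last first.
  by move=> i _; apply: differentiable_funM => //; exact: dF.
apply: eq_bigr => i _.
rewrite dirM //; last exact: dF.
rewrite -!pd_dir -/(pdx j (fun w => momentum w i) z) pdx_momentum mul0r add0r.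
by rewrite -/(pdx j (pdp i F) z) (pdxpC _ _ Ksq_smooth Dz).
Qed.

Definition Pup z : 'rV[R]_n := rsubmx z *m Gup z.

Lemma PupE j z : D z -> Pup z 0 j = 2^-1 * pdp j F z.
Proof.
move=> Dz; rewrite mxE -euler_dpF // mulr_sumr; apply: eq_bigr => i _.
by rewrite [Gup z i j]mxE /momentum; ring.
Qed.

Lemma Pup_glo z : D z -> Pup z *m Glo z = rsubmx z.
Proof. by move=> Dz; rewrite /Pup -mulmxA gupK // mulmx1. Qed.

Lemma Pup_smooth : smooth_mx D Pup.
Proof.
apply: smooth_mulmx => //; last exact: gup_smooth.
by move=> i j; rewrite ord1; under eq_fun do rewrite mxE; exact: smooth_coord.
Qed.

Lemma rsubmx_Pup z : D z -> rsubmx z *m (Pup z)^T = (F z)%:M.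
Proof.
move=> Dz; apply/matrixP => i j; rewrite !ord1 !mxE eqxx mulr1n.
apply: (@mulfI _ 2) => //; rewrite -euler_Ksq // mulr_sumr.
apply: eq_bigr => k _; rewrite [(Pup z)^T _ _]mxE PupE // /momentum.
by field.
Qed.

(** * The canonical nonlinear connection *)

Definition dxKsq z : 'rV[R]_n := \row_i pdx i F z.

Definition Nmx z : 'M[R]_n := \matrix_(i, j) Ncoef K i j z.

(* The Hamiltonian vector field of [K ^ 2 / 2]; it turns out to be [xi]. *)
Definition ham z : 'rV[R]_(n + n) := row_mx (Pup z) (- 2^-1 *: dxKsq z).

Lemma pd_Pup a k z : D z ->
  pd a (fun w => Pup w 0 k) z = 2^-1 * pd a (pdp k F) z.
Proof.
move=> Dz; transitivity (pd a (fun w => 2^-1 * pdp k F w) z).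
  by apply: near_eq_pd; exact: near_eq_dom Dz (PupE k).
rewrite [LHS]pd_dir dirZ; first by rewrite -pd_dir.
exact: smooth_diff (pdp_smooth k Ksq_smooth) Dz.
Qed.

Lemma pdp_Pup i k z : D z -> pdp i (fun w => Pup w 0 k) z = Gup z i k.
Proof. by move=> Dz; rewrite /pdp pd_Pup // mxE. Qed.

Lemma dxPupE i k z : D z -> dxm Pup z i k = 2^-1 * pdp k (pdx i F) z.
Proof.
move=> Dz; rewrite mxE /pdx pd_Pup; last by [].
rewrite -/(pdx i (pdp k F) z).
by rewrite (pdxpC _ _ Ksq_smooth Dz).
Qed.

Lemma bracket_Ksq f z : D z -> bracket f F z = - 2 * dir ham f z.
Proof.
move=> Dz; rewrite dir_split /bracket -big_split mulr_sumr.
apply: eq_bigr => i _ /=.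
rewrite /ham row_mxEl row_mxEr PupE // !mxE.
by field.
Qed.

(** The bracket with K^2 is -2 times the derivative along [ham], and the mixed second derivative of
    K^2 in p_k and x^j is twice dp^k/dx^j; both turn the factor 1/4 into 1/2. *)
Lemma NmxE z : D z -> Nmx z =
  - 2^-1 *: (dmx ham Glo z + Glo z *m (dxm Pup z)^T + dxm Pup z *m Glo z).
Proof.
move=> Dz; apply/matrixP => i j.
have E1 : \sum_k Glo z i k * pdp k (pdx j F) z = 2 * (Glo z *m (dxm Pup z)^T) i j.
  rewrite mxE mulr_sumr; apply: eq_bigr => k _.
  rewrite [(dxm _ _)^T _ _]mxE dxPupE; last by [].
  by move: (pdp k _ z) => x; field.
have E2 : \sum_k Glo z j k * pdp k (pdx i F) z = 2 * (dxm Pup z *m Glo z) i j.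
  rewrite mxE mulr_sumr; apply: eq_bigr => k _.
  rewrite dxPupE; last by [].
  rewrite -[in LHS](glo_sym Dz) [(Glo z)^T _ _]mxE.
  by move: (pdp k _ z) => x; field.
rewrite [LHS]mxE /Ncoef big_split /=.
etransitivity.
  exact: (congr2 (fun x y => 4^-1 * x - 4^-1 * y) (bracket_Ksq _ Dz) (congr2 +%R E1 E2)).
rewrite scalemxE !addmxE [dmx _ _ _ _ _]mxE.
by move: (dir _ _ _) (_ i j) (_ i j) => x y t; field.
Qed.

Lemma Nmx_sym z : D z -> (Nmx z)^T = Nmx z.
Proof.
move=> Dz; rewrite NmxE // linearZ /= !linearD /= -dmxT.
rewrite (near_eq_dmx _ (near_eq_dom Dz glo_sym)).
by rewrite !trmx_mul trmxK glo_sym // addrAC.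
Qed.

Lemma Nmx_smooth : smooth_mx D Nmx.
Proof. by move=> i j; under eq_fun do rewrite mxE; exact: Ncoef_smooth. Qed.

Lemma mdiff_Nmx z : D z -> mdiff Nmx z.
Proof. exact: smooth_mx_diff Nmx_smooth. Qed.

Lemma mdiff_Pup z : D z -> mdiff Pup z.
Proof. exact: smooth_mx_diff Pup_smooth. Qed.

Lemma mdiff_gup z : D z -> mdiff Gup z.
Proof. exact: smooth_mx_diff gup_smooth. Qed.

Lemma mdiff_glo z : D z -> mdiff Glo z.
Proof. exact: smooth_mx_diff glo_smooth. Qed.

Lemma dmx_rsubmx V z : dmx V (@rsubmx R 1 n n) z = rsubmx (V z).
Proof.
apply/matrixP => i j; rewrite ord1 !mxE; under eq_fun do rewrite mxE.
exact: dir_coord.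
Qed.

Lemma dpm_Pup z : D z -> dpm Pup z = Gup z.
Proof. by move=> Dz; apply/matrixP => i k; rewrite [LHS]mxE pdp_Pup. Qed.

Lemma dmx_ham_Pup z : D z ->
  dmx ham Pup z = Pup z *m dxm Pup z - 2^-1 *: (dxKsq z *m Gup z).
Proof.
move=> Dz; rewrite dmx_split dpm_Pup; last by [].
by rewrite /ham row_mxKl row_mxKr -scalemxAl scaleNr.
Qed.

Lemma rsubmx_dxPup z : D z -> rsubmx z *m (dxm Pup z)^T = dxKsq z.
Proof.
move=> Dz; apply/matrixP => i j; rewrite !ord1 {i} [RHS]mxE.
apply: (@mulfI _ 2) => //; rewrite -(euler_dxF _ Dz) [X in _ * X]mxE mulr_sumr.
apply: eq_bigr => k _.
rewrite [(dxm _ _)^T _ _]mxE dxPupE; last by [].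
by rewrite /momentum; move: (pdp k _ z) => x; field.
Qed.

(** Deriving p^i g_ij = p_j along [ham] shows that the first and the last term of [NmxE] cancel
    after contraction with p^i; the middle one becomes p_k dp^k/dx^j, which is dK^2/dx^j by
    homogeneity. This identifies [xi] with [ham]. *)
Lemma Pup_Nmx z : D z -> Pup z *m Nmx z = - 2^-1 *: dxKsq z.
Proof.
move=> Dz; rewrite NmxE; last by [].
have E : dmx ham (fun w => Pup w *m Glo w) z = - 2^-1 *: dxKsq z.
  rewrite (near_eq_dmx _ (near_eq_dom Dz Pup_glo)) dmx_rsubmx /ham.
  by rewrite row_mxKr.
move: E; rewrite dmxM; [|exact: mdiff_Pup|exact: mdiff_glo].
rewrite dmx_ham_Pup; last by [].
rewrite -scalemxAr !mulmxDr !mulmxA Pup_glo // rsubmx_dxPup // mulmxBl.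
rewrite -scalemxAl -[dxKsq z *m _ *m _]mulmxA gupK // mulmx1.
move/(congr1 (fun x => x - (Pup z *m dxm Pup z *m Glo z - 2^-1 *: dxKsq z))).
rewrite addrC addKr => ->; rewrite scaleNr.
apply/matrixP => i j; rewrite !mxlinE.
by move: (dxKsq z i j) (_ i j) => x y; field.
Qed.

Definition qmx z : 'rV[R]_n := Pup z *m Nmx z.

Lemma qmxE z : D z -> qmx z = - 2^-1 *: dxKsq z.
Proof. exact: Pup_Nmx. Qed.

Lemma deltaE i z : delta K i z = row_mx (delta_mx 0 i) (row i (Nmx z)).
Proof.
apply/matrixP => r c; rewrite ord1 {r} /delta mxE summxE.
case: (split_ordP c) => k ->; rewrite ?row_mxEl ?row_mxEr !mxE !eqxx /=.
  rewrite eq_lshift big1 ?addr0 // => j _.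
  by rewrite !mxE !eqxx /= eq_lrshift mulr0.
rewrite eq_rlshift add0r (bigD1 k) //= !mxE !eqxx mulr1 big1 ?addr0 // => j jk.
by rewrite !mxE eqxx /= eq_rshift eq_sym (negPf jk) mulr0.
Qed.

Lemma xiE z : xi K z = row_mx (Pup z) (qmx z).
Proof.
have -> : xi K z = \sum_j Pup z 0 j *: delta K j z.
  rewrite /xi exchange_big; apply: eq_bigr => j _.
  by rewrite -scaler_suml /Pup mxE.
under eq_bigr do rewrite deltaE scale_row_mx.
rewrite -[LHS]hsubmxK !linear_sum /=; congr row_mx.
  by rewrite [RHS]row_sum_delta; apply: eq_bigr => j _; rewrite row_mxKl.
rewrite /qmx mulmx_sum_row; apply: eq_bigr => j _.
by rewrite row_mxKr.
Qed.

Lemma xi_ham z : D z -> xi K z = ham z.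
Proof. by move=> Dz; rewrite xiE qmxE. Qed.

(** * The adapted frame *)

(** Row i holds the derivatives along [delta K i]. *)
Definition dlm (s : nat) (A : 'rV[R]_(n + n) -> 'rV[R]_s) z : 'M[R]_(n, s) :=
  dxm A z + Nmx z *m dpm A z.

(** [hor] and [ver] are the components in the frame of the [delta K i] and the d/dp_i. The transpose
    in [ver] follows [deltap], which sums over the second index of [Ncoef]. *)
Definition hor (X : 'rV[R]_(n + n) -> 'rV[R]_(n + n)) z : 'rV[R]_n := lsubmx (X z).

Definition ver (X : 'rV[R]_(n + n) -> 'rV[R]_(n + n)) z : 'rV[R]_n :=
  rsubmx (X z) - hor X z *m (Nmx z)^T.

Lemma dir_delta (s : nat) (A : 'rV[R]_(n + n) -> 'rV[R]_s) i k z :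
  dir (delta K i) (fun w => A w 0 k) z = dlm A z i k.
Proof.
have -> : dir (delta K i) (fun w => A w 0 k) z = dmx (delta K i) A z 0 k by rewrite mxE.
rewrite dmx_split deltaE row_mxKl row_mxKr -rowE -row_mul addmxE /dlm addmxE.
by rewrite [row _ _ _ _]mxE [row _ (_ *m _) _ _]mxE.
Qed.

Lemma dmx_adapted (s : nat) (A : 'rV[R]_(n + n) -> 'rV[R]_s) X z : D z ->
  dmx X A z = hor X z *m dlm A z + ver X z *m dpm A z.
Proof.
move=> Dz; rewrite dmx_split /dlm /ver Nmx_sym // mulmxBl mulmxDr mulmxA -/(hor X z).
by rewrite [RHS]addrACA [X in _ = _ + X]subrr [RHS]addr0.
Qed.

Lemma hor_xi z : hor (xi K) z = Pup z.
Proof. by rewrite /hor xiE row_mxKl. Qed.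

Lemma ver_xi z : D z -> ver (xi K) z = 0.
Proof. by move=> Dz; rewrite /ver hor_xi xiE row_mxKr Nmx_sym // subrr. Qed.

Lemma dmx_xi (s : nat) (A : 'rV[R]_(n + n) -> 'rV[R]_s) z : D z ->
  dmx (xi K) A z = Pup z *m dlm A z.
Proof. by move=> Dz; rewrite dmx_adapted // ver_xi // mul0mx addr0 hor_xi. Qed.

Lemma dlm_Pup z : D z -> dlm Pup z = dxm Pup z + Nmx z *m Gup z.
Proof. by move=> Dz; rewrite /dlm dpm_Pup. Qed.

Lemma dmx_ext (V W : 'rV[R]_(n + n) -> 'rV[R]_(n + n)) (r s : nat)
  (A : 'rV[R]_(n + n) -> 'M[R]_(r, s)) z : V z = W z -> dmx V A z = dmx W A z.
Proof. by move=> VW; apply/matrixP => i j; rewrite !mxE; apply: dir_ext. Qed.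

(** This is [NmxE] solved for the derivative of g_ij: since [dlm Pup] is B + N g^-1 with B =
    [dxm Pup], each of the two products contributes one copy of N. *)
Lemma dmx_xi_glo z : D z ->
  dmx (xi K) Glo z = - (dlm Pup z *m Glo z + Glo z *m (dlm Pup z)^T).
Proof.
move=> Dz; rewrite (dmx_ext _ (xi_ham Dz)) dlm_Pup //.
have := NmxE Dz; move: (dmx ham Glo z) => T.
move/(congr1 (fun x => - 2 *: x)); rewrite scalerA mulNr mulrN opprK divff //.
rewrite scale1r => /esym/(canRL (addrK _))/(canRL (addrK _)) ->.
rewrite mulmxDl -!mulmxA gupK // mulmx1 [(_ + _)^T]linearD /= trmx_mul gup_sym // Nmx_sym //.
rewrite mulmxDr mulmxA gloK // mul1mx.
apply/matrixP => i j; rewrite !mxlinE.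
by move: (Nmx z i j) ((dxm Pup z *m Glo z) i j) ((Glo z *m _) i j) => x y t; ring.
Qed.

Lemma dmx_cst V (r s : nat) (A : 'M[R]_(r, s)) z : dmx V (fun=> A) z = 0.
Proof. by apply/matrixP => i j; rewrite !mxE dir_cst. Qed.

Lemma dmx_xi_gup z : D z ->
  dmx (xi K) Gup z = Gup z *m dlm Pup z + (dlm Pup z)^T *m Gup z.
Proof.
move=> Dz; have : dmx (xi K) (fun w => Gup w *m Glo w) z = 0.
  by rewrite (near_eq_dmx _ (near_eq_dom Dz gupK)) dmx_cst.
rewrite dmxM; [|exact: mdiff_gup|exact: mdiff_glo].
move/(congr1 (mulmx^~ (Gup z))); rewrite mul0mx mulmxDl -mulmxA gloK // mulmx1.
rewrite dmx_xi_glo // => /(canRL (addrK _)) ->.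
rewrite sub0r mulmxN mulNmx opprK mulmxDr mulmxDl.
by rewrite !mulmxA gupK // mul1mx -!mulmxA gloK // mulmx1.
Qed.

Lemma dlmE (s : nat) (A : 'rV[R]_(n + n) -> 'rV[R]_s) z :
  dlm A z = dxm A z + Nmx z *m dpm A z.
Proof. by []. Qed.

(** * The curvature contracted with the momenta *)

Definition Rmx z : 'M[R]_n := \matrix_(i, j) Rtensor K i j z.

Lemma dir_xi f z : dir (xi K) f z = \sum_j Pup z 0 j * dir (delta K j) f z.
Proof.
rewrite /dir xiE; under [RHS]eq_bigr do rewrite mulr_sumr.
rewrite exchange_big; apply: eq_bigr => a _ /=.
under eq_bigr do rewrite mulrA.
rewrite -mulr_suml; congr (_ * _).
under eq_bigr do rewrite deltaE.
case: (split_ordP a) => k ->.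
  rewrite row_mxEl {1}[Pup z]row_sum_delta summxE; apply: eq_bigr => j _.
  by rewrite scalemxE row_mxEl.
rewrite row_mxEr /qmx mulmx_sum_row summxE; apply: eq_bigr => j _.
by rewrite scalemxE row_mxEr.
Qed.

(** In p^m R_imk the Leibniz rule moves p^m inside the derivative along [delta K i], where it forms
    q_k = p^m N_mk; the other half of [Rcurv] sums to a derivative along xi = p^m delta_m. *)
Lemma RmxE z : D z ->
  Rmx z = dlm qmx z - dlm Pup z *m Nmx z - dmx (xi K) Nmx z.
Proof.
move=> Dz; apply/matrixP => i k; rewrite [LHS]mxE.
rewrite (addmxE (dlm qmx z - _)) [(- dmx _ _ _) i k]oppmxE (addmxE (dlm qmx z)).
rewrite [(- (_ *m _)) i k]oppmxE -[dlm qmx z i k]dir_delta [(dlm Pup z *m _) i k]mxE.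
rewrite [dmx _ _ _ _ _]mxE dir_xi /Rtensor exchange_big /=.
transitivity (\sum_m Pup z 0 m * Rcurv K i m k z).
  by apply: eq_bigr => m _; rewrite -mulr_suml /Pup mxE.
have E : dir (delta K i) (fun w => qmx w 0 k) z =
   \sum_m (dlm Pup z i m * Nmx z m k + Pup z 0 m * dir (delta K i) (Ncoef K m k) z).
  rewrite /qmx; under [X in dir _ X]eq_fun do rewrite mxE.
  rewrite dir_sum; last first.
    by move=> m _; apply: differentiable_funM; [exact: mdiff_Pup|exact: mdiff_Nmx].
  apply: eq_bigr => m _; rewrite dirM; [|exact: mdiff_Pup|exact: mdiff_Nmx].
  rewrite dir_delta; congr (_ + _ * _).
  by under [X in dir _ X]eq_fun do rewrite mxE.
rewrite [X in _ = X - _ - _]E big_split /= [X in _ = X - _ - _]addrC addrK -sumrB.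
apply: eq_bigr => m _; rewrite -mulrBr /Rcurv.
by under [X in _ = _ * (_ - dir _ X _)]eq_fun do rewrite mxE.
Qed.

Lemma dpm_qmx z : D z -> dpm qmx z = - (dxm Pup z)^T.
Proof.
move=> Dz; apply/matrixP => i k; rewrite oppmxE [(dxm _ _)^T _ _]mxE dxPupE; last by [].
rewrite [LHS]mxE /pdp (@near_eq_pd _ _ _ (fun w => - 2^-1 * pdx k F w)).
  rewrite pd_dir dirZ; last exact: smooth_diff (pdx_smooth k Ksq_smooth) Dz.
  by rewrite -pd_dir mulNr.
apply: near_eq_dom Dz _ => w Dw; rewrite qmxE //.
by rewrite scalemxE [dxKsq _ _ _]mxE.
Qed.

Lemma dxm_qmx_sym z : D z -> (dxm qmx z)^T = dxm qmx z.
Proof.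
move=> Dz.
have E i k : dxm qmx z i k = - 2^-1 * pdx i (pdx k F) z.
  rewrite mxE /pdx (@near_eq_pd _ _ _ (fun w => - 2^-1 * pdx k F w)).
    rewrite pd_dir dirZ; last exact: smooth_diff (pdx_smooth k Ksq_smooth) Dz.
    by rewrite -pd_dir.
  apply: near_eq_dom Dz _ => w Dw; rewrite qmxE //.
  by rewrite scalemxE [dxKsq _ _ _]mxE.
apply/matrixP => i k; rewrite [LHS]mxE !E.
by rewrite (pdxC _ _ Ksq_smooth Dz).
Qed.

(** Since q = - 1/2 dK^2/dx, the matrix is S - N B^T - B N - N g^-1 N - xi(N), with B = [dxm Pup]
    and S minus half the Hessian of K^2 in x; transposition exchanges the two terms in B and fixes
    the others. *)
Lemma Rmx_sym z : D z -> (Rmx z)^T = Rmx z.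
Proof.
move=> Dz; rewrite RmxE // dlm_Pup // dlmE dpm_qmx // mulmxN.
set S := dxm qmx z; set B := dxm Pup z.
rewrite mulmxDl !(trmxD, trmxN) -dmxT (near_eq_dmx _ (near_eq_dom Dz Nmx_sym)).
rewrite !trmx_mul trmxK Nmx_sym // gup_sym // dxm_qmx_sym // mulmxA.
move: (dmx _ _ _) (Gup z) => T G.
apply/matrixP => i j; rewrite !mxlinE.
by move: (S i j) (T i j) ((_ *m B^T) i j) ((B *m _) i j) => x y t u; ring.
Qed.

(** The contraction p^i p^k R_ikj of a symbol antisymmetric in i and k; through [RmxE] it is the
    Leibniz rule for the derivative of q = p^i N_ij along [xi]. *)
Lemma Pup_Rmx z : D z -> Pup z *m Rmx z = 0.
Proof.
move=> Dz; rewrite RmxE // !mulmxBr -dmx_xi // /qmx.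
rewrite dmxM; [|exact: mdiff_Pup|exact: mdiff_Nmx].
by rewrite dmx_xi // mulmxA addrAC addrK subrr.
Qed.

Lemma Rmx_Pup z : D z -> Rmx z *m (Pup z)^T = 0.
Proof. by move=> Dz; rewrite -[Rmx z]Rmx_sym // -trmx_mul Pup_Rmx // trmx0. Qed.

Lemma dpm_qmx_sub z : D z -> dpm qmx z - Gup z *m Nmx z = - (dlm Pup z)^T.
Proof.
move=> Dz; rewrite dpm_qmx // dlm_Pup // trmxD trmx_mul gup_sym // Nmx_sym //.
by rewrite opprD.
Qed.

Lemma hor_diff X z : mdiff X z -> mdiff (hor X) z.
Proof. by move=> dX i j; rewrite ord1 /hor; under eq_fun do rewrite mxE; exact: dX. Qed.

Lemma ver_diff X z : D z -> mdiff X z -> mdiff (ver X) z.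
Proof.
move=> Dz dX i j; rewrite /ver; under eq_fun do rewrite addmxE oppmxE.
apply: differentiable_funD.
  by rewrite ord1; under eq_fun do rewrite mxE; exact: dX.
apply: differentiable_funN; apply: mdiffM; first exact: hor_diff.
by apply: mdiffT; exact: mdiff_Nmx.
Qed.

(** * Brackets with [xi] in adapted components *)

Lemma hor_lie_bracket_xi X z : D z -> mdiff X z ->
  hor (lie_bracket (xi K) X) z =
  dmx (xi K) (hor X) z - hor X z *m dlm Pup z - ver X z *m Gup z.
Proof.
move=> Dz dX; rewrite -[LHS]/(lsubmx (lie_bracket (xi K) X z)).
have hE (V : 'rV[R]_(n + n) -> 'rV[R]_(n + n)) (Y : 'rV[R]_(n + n) -> 'rV[R]_(n + n)) :
    lsubmx (dmx V Y z) = dmx V (hor Y) z.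
  apply/matrixP => i j; rewrite ord1 !mxE /hor.
  by under [X in _ = dir _ X _]eq_fun do rewrite mxE.
have -> : lsubmx (lie_bracket (xi K) X z) = dmx (xi K) (hor X) z - dmx X (hor (xi K)) z.
  by rewrite lie_bracketE -!hE; apply/matrixP => i j; rewrite !mxE.
rewrite (_ : hor (xi K) = Pup); last by rewrite funeqE => w; exact: hor_xi.
by rewrite (dmx_adapted Pup) // dpm_Pup // opprD addrA.
Qed.

(** The vertical part of [delta_i, delta_j] is R_ijk d/dp_k; contracted with p^i it is - R_jk,
    whence the term in [Rmx]. The last term comes from the brackets of [xi] with the d/dp_i, through
    [dpm_qmx_sub]. *)
Lemma ver_lie_bracket_xi X z : D z -> mdiff X z ->
  ver (lie_bracket (xi K) X) z =
  dmx (xi K) (ver X) z - hor X z *m Rmx z + ver X z *m (dlm Pup z)^T.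
Proof.
move=> Dz dX; rewrite /ver (hor_lie_bracket_xi Dz dX) -/(ver X z) -/(ver X).
have dh := hor_diff dX; have dv := ver_diff Dz dX.
have dN := mdiff_Nmx Dz.
have rE V (Y : 'rV[R]_(n + n) -> 'rV[R]_(n + n)) :
    rsubmx (dmx V Y z) = dmx V (fun w => rsubmx (Y w)) z.
  apply/matrixP => i j; rewrite ord1 !mxE.
  by under [X in _ = dir _ X _]eq_fun do rewrite mxE.
have -> : rsubmx (lie_bracket (xi K) X z) =
    dmx (xi K) (fun w => rsubmx (X w)) z - dmx X qmx z.
  have -> : qmx = (fun w => rsubmx (xi K w)).
    by rewrite funeqE => w; rewrite xiE row_mxKr.
  by rewrite lie_bracketE -!rE; apply/matrixP => i j; rewrite !mxE.
have -> : (fun w => rsubmx (X w)) = (fun w => ver X w + hor X w *m (Nmx w)^T).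
  by rewrite funeqE => w; rewrite /ver addrNK.
rewrite dmxD //; last by apply: mdiffM => //; exact: mdiffT.
rewrite dmxM //; last exact: mdiffT.
rewrite dmxT -dmxT (near_eq_dmx _ (near_eq_dom Dz Nmx_sym)) Nmx_sym //.
rewrite (dmx_adapted qmx) // RmxE //.
have := dpm_qmx_sub Dz => /(canRL (subrK _)) ->.
move: (dmx (xi K) (ver X) z) (dmx (xi K) (hor X) z) (dmx (xi K) Nmx z) => dv' dh' dN'.
move: (dlm qmx z) (dlm Pup z) (hor X z) (ver X z) (Nmx z) (Gup z) => B A h v N G.
rewrite !(mulmxBr, mulmxBl, mulmxDr, mulmxDl, mulmxN, mulNmx, mulmxA).
by apply/matrixP => i j; rewrite !mxlinE; ring.
Qed.

(** * The Sasaki metric and its Lie derivative along [xi] *)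

Lemma sasakiE z u v : sasaki K z u v =
  (lsubmx u *m Glo z *m (lsubmx v)^T +
   (rsubmx u - lsubmx u *m (Nmx z)^T) *m Gup z *m
   (rsubmx v - lsubmx v *m (Nmx z)^T)^T) 0 0.
Proof.
have dE w i : deltap K i z w = (rsubmx w - lsubmx w *m (Nmx z)^T) 0 i.
  rewrite addmxE oppmxE [rsubmx _ _ _]mxE [(_ *m _) 0 i]mxE; congr (_ - _).
  by apply: eq_bigr => j _; rewrite !mxE mulrC.
have qE (B : 'M[R]_n) (x y : 'rV[R]_n) :
    (x *m B *m y^T) 0 0 = \sum_i \sum_j B i j * x 0 i * y 0 j.
  rewrite mxE exchange_big; apply: eq_bigr => j _.
  rewrite [(x *m _) 0 j]mxE [y^T _ _]mxE mulr_suml; apply: eq_bigr => i _.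
  by rewrite [x 0 i * _]mulrC.
rewrite addmxE !qE /sasaki; congr (_ + _); apply: eq_bigr => i _; apply: eq_bigr => j _.
  by rewrite ![lsubmx _ _ _]mxE.
by rewrite !dE.
Qed.

(** Right multiplication by it turns coordinates into adapted components. It is unipotent, so
    invertibility of the metric reduces to that of the diagonal blocks. *)
Definition adapted_mx z : 'M[R]_(n + n) := block_mx 1%:M (- (Nmx z)^T) 0 1%:M.

Lemma mul_adapted_mx z (w : 'rV[R]_(n + n)) :
  w *m adapted_mx z = row_mx (lsubmx w) (rsubmx w - lsubmx w *m (Nmx z)^T).
Proof.
rewrite -[w in LHS]hsubmxK mul_row_block !mulmx1 mulmx0 addr0 mulmxN.
by rewrite [- _ + _]addrC.
Qed.

Lemma sasaki_mxE z : sasaki_mx K z =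
  adapted_mx z *m block_mx (Glo z) 0 0 (Gup z) *m (adapted_mx z)^T.
Proof.
set S := RHS; have SE w w' : sasaki K z w w' = (w *m S *m w'^T) 0 0.
  rewrite /S -!mulmxA -trmx_mul !mulmxA !mul_adapted_mx mul_row_block !mulmx0 addr0 add0r.
  by rewrite tr_row_mx mul_row_col -sasakiE.
apply/matrixP => a b; rewrite mxE SE trmx_delta -rowE -colE !mxE.
by [].
Qed.

Lemma sasaki_formE z u v : sasaki K z u v = (u *m sasaki_mx K z *m v^T) 0 0.
Proof.
rewrite sasaki_mxE -!mulmxA -trmx_mul !mulmxA !mul_adapted_mx mul_row_block.
by rewrite !mulmx0 addr0 add0r tr_row_mx mul_row_col -sasakiE.
Qed.

Lemma sasaki_mx_sym z : D z -> (sasaki_mx K z)^T = sasaki_mx K z.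
Proof.
move=> Dz; rewrite sasaki_mxE !trmx_mul trmxK tr_block_mx glo_sym // gup_sym //.
by rewrite !trmx0 mulmxA.
Qed.

Lemma sasaki_mx_unit z : D z -> sasaki_mx K z \in unitmx.
Proof.
move=> Dz; rewrite sasaki_mxE !unitmx_mul unitmx_tr /adapted_mx !unitmxE !det_ublock.
by rewrite !det1 mulr1 !unitrM -!unitmxE gup_unit // unitmx_inv gup_unit // unitr1.
Qed.

Lemma smooth_block_mx (r1 r2 s1 s2 : nat) (A : 'rV[R]_(n + n) -> 'M[R]_(r1, s1))
    (B : 'rV[R]_(n + n) -> 'M[R]_(r1, s2)) (A' : 'rV[R]_(n + n) -> 'M[R]_(r2, s1))
    (B' : 'rV[R]_(n + n) -> 'M[R]_(r2, s2)) :
  smooth_mx D A -> smooth_mx D B -> smooth_mx D A' -> smooth_mx D B' ->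
  smooth_mx D (fun z => block_mx (A z) (B z) (A' z) (B' z)).
Proof.
move=> sA sB sA' sB' i j.
case: (split_ordP i) => k ->; case: (split_ordP j) => l ->.
- by under eq_fun do rewrite block_mxEul; exact: sA.
- by under eq_fun do rewrite block_mxEur; exact: sB.
- by under eq_fun do rewrite block_mxEdl; exact: sA'.
- by under eq_fun do rewrite block_mxEdr; exact: sB'.
Qed.

Lemma sasaki_mx_smooth : smooth_mx D (sasaki_mx K).
Proof.
rewrite (_ : sasaki_mx K = fun z => adapted_mx z *m block_mx (Glo z) 0 0 (Gup z) *m
  (adapted_mx z)^T); last by rewrite funeqE => z; exact: sasaki_mxE.
have s0 (r s : nat) (A : 'M[R]_(r, s)) : smooth_mx D (fun=> A).
  by move=> i j; exact: smooth_cst.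
have sT : smooth_mx D adapted_mx.
  apply: smooth_block_mx; [exact: s0| |exact: s0|exact: s0].
  move=> i j; under eq_fun do rewrite oppmxE.
  by apply: smoothN => //; apply: smooth_tr; exact: Nmx_smooth.
apply: smooth_mulmx => //; last exact: smooth_tr.
apply: smooth_mulmx => //.
by apply: smooth_block_mx; [exact: glo_smooth|exact: s0|exact: s0|exact: gup_smooth].
Qed.

Lemma inner_sasaki X Y z : inner (sasaki_mx K) X Y z =
  (hor X z *m Glo z *m (hor Y z)^T + ver X z *m Gup z *m (ver Y z)^T) 0 0.
Proof. by rewrite innerE -sasaki_formE sasakiE. Qed.

(* For the canonical connection, the horizontal and the vertical blocks of
   [L_xi G] vanish, so that only the mixed block [R_ik g^kj + delta_i^j]
   remains. *)
Lemma lie_metric_xi X Y z : D z -> mdiff X z -> mdiff Y z ->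
  lie_metric (sasaki_mx K) (xi K) X Y z =
  (hor X z *m (1%:M + Rmx z *m Gup z) *m (ver Y z)^T +
   hor Y z *m (1%:M + Rmx z *m Gup z) *m (ver X z)^T) 0 0.
Proof.
move=> Dz dX dY; rewrite /lie_metric.
have dhX := hor_diff dX; have dvX := ver_diff Dz dX.
have dhY := hor_diff dY; have dvY := ver_diff Dz dY.
have -> : dir (xi K) (inner (sasaki_mx K) X Y) z =
    dmx (xi K) (fun w => hor X w *m Glo w *m (hor Y w)^T +
                         ver X w *m Gup w *m (ver Y w)^T) z 0 0.
  by rewrite mxE; congr dir; rewrite funeqE => w; exact: inner_sasaki.
have dG := mdiff_gup Dz; have dg := mdiff_glo Dz.
have d1 := mdiffM dhX dg; have d2 := mdiffM dvX dG.
have d3 := mdiffT dhY; have d4 := mdiffT dvY.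
rewrite dmxD; [|exact: mdiffM|exact: mdiffM].
rewrite (dmxM _ d1 d3) (dmxM _ dhX dg) (dmxM _ d2 d4) (dmxM _ dvX dG) !dmxT.
rewrite dmx_xi_glo // dmx_xi_gup // !inner_sasaki.
rewrite !ver_lie_bracket_xi // !hor_lie_bracket_xi //.
have E (A B : 'M[R]_1) : A 0 0 - B 0 0 = (A - B) 0 0 by rewrite !mxE.
rewrite !E; congr (fun_of_matrix _ 0 0).
apply: lie_metric_algebra; [exact: gupK|exact: gloK|exact: gup_sym
  |exact: glo_sym|exact: Rmx_sym].
Qed.

(** * The angular curvature and the level sets of K *)

Definition angular_mx z : 'M[R]_n := \matrix_(i, j) angular_curvature K i j z.

Lemma angular_mxE z : angular_mx z =
  Rmx z + Glo z - (F z)^-1 *: ((rsubmx z)^T *m rsubmx z).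
Proof.
apply/matrixP => i j; rewrite [LHS]mxE /angular_curvature /angular_metric.
rewrite addmxE addmxE oppmxE scalemxE [Rmx z i j]mxE [(_ *m rsubmx z) i j]mxE.
by rewrite big_ord1 [(rsubmx z)^T _ _]mxE -addrA mulrA.
Qed.

Lemma glo_Pup z : D z -> Glo z *m (Pup z)^T = (rsubmx z)^T.
Proof. by move=> Dz; rewrite -[in LHS]glo_sym // -trmx_mul Pup_glo. Qed.

Lemma rsubmx_PupC z : D z -> Pup z *m (rsubmx z)^T = (F z)%:M.
Proof. by move=> Dz; rewrite -[LHS]trmxK trmx_mul trmxK rsubmx_Pup // tr_scalar_mx. Qed.

Lemma Ksq_neq0 z : D z -> F z != 0.
Proof. by move=> Dz; rewrite gt_eqF ?Ksq_gt0. Qed.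

Lemma angular_mx_Pup z : D z -> angular_mx z *m (Pup z)^T = 0.
Proof.
move=> Dz; rewrite angular_mxE mulmxBl mulmxDl Rmx_Pup // add0r glo_Pup //.
rewrite -scalemxAl -mulmxA rsubmx_Pup // mul_mx_scalar scalerA mulVf ?Ksq_neq0 //.
by rewrite scale1r subrr.
Qed.

Lemma Pup_angular_mx z : D z -> Pup z *m angular_mx z = 0.
Proof.
move=> Dz; rewrite angular_mxE mulmxBr mulmxDr Pup_Rmx // add0r Pup_glo //.
rewrite -scalemxAr mulmxA rsubmx_PupC // mul_scalar_mx scalerA mulVf ?Ksq_neq0 //.
by rewrite scale1r subrr.
Qed.

(** One has 1 + R g^-1 = (R + g) g^-1, and the term p_i p_j / K^2 that separates R + g from the
    angular curvature vanishes here: through g^-1 it pairs p^j with the vertical part of a tangent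
    vector. *)
Lemma lie_metric_xi_angular X Y z : D z -> mdiff X z -> mdiff Y z ->
  ver X z *m (Pup z)^T = 0 -> ver Y z *m (Pup z)^T = 0 ->
  lie_metric (sasaki_mx K) (xi K) X Y z =
  (hor X z *m angular_mx z *m Gup z *m (ver Y z)^T +
   hor Y z *m angular_mx z *m Gup z *m (ver X z)^T) 0 0.
Proof.
move=> Dz dX dY tX tY; rewrite lie_metric_xi //.
have E (h v : 'rV[R]_n) : v *m (Pup z)^T = 0 ->
    h *m (1%:M + Rmx z *m Gup z) *m v^T = h *m angular_mx z *m Gup z *m v^T.
  move=> tv; have Gv : (rsubmx z)^T *m rsubmx z *m Gup z *m v^T = 0.
    rewrite -!mulmxA [_ *m (Gup z *m _)]mulmxA -/(Pup z).
    by rewrite -[Pup z *m _]trmxK trmx_mul trmxK tv trmx0 mulmx0.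
  rewrite -!mulmxA; congr (h *m _); rewrite angular_mxE !mulmxA mulmxBl mulmxBl.
  rewrite -!scalemxAl Gv scaler0 subr0; congr (_ *m _).
  by rewrite mulmxDl gloK // addrC.
by rewrite !E.
Qed.

(** As p^i N_ij = - 1/2 dK^2/dx^j, horizontal vectors annihilate K^2; only the vertical part
    contributes, paired with p^i = 1/2 dK^2/dp_i. *)
Lemma dir_Ksq X z : D z -> dir X F z = 2 * (ver X z *m (Pup z)^T) 0 0.
Proof.
move=> Dz; rewrite dir_split.
have -> : \sum_i X z 0 (lshift n i) * pdx i F z = (hor X z *m (dxKsq z)^T) 0 0.
  rewrite mxE; apply: eq_bigr => i _.
  by rewrite [hor _ _ _ _]mxE [(dxKsq z)^T _ _]mxE [dxKsq _ _ _]mxE.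
have -> : \sum_i X z 0 (rshift n i) * pdp i F z = 2 * (rsubmx (X z) *m (Pup z)^T) 0 0.
  rewrite mxE mulr_sumr; apply: eq_bigr => i _.
  rewrite [rsubmx _ _ _]mxE [(Pup z)^T _ _]mxE PupE; last by [].
  by move: (pdp i F z) => x; field.
rewrite /ver mulmxBl -mulmxA -trmx_mul -/(qmx z) qmxE // linearZ /= -scalemxAr.
by rewrite addmxE oppmxE scalemxE; move: (_ 0 0) (_ 0 0) => x y; field.
Qed.

Lemma dir_K_eq0 X z : D z -> dir X K z = 0 <-> ver X z *m (Pup z)^T = 0.
Proof.
move=> Dz; have E : dir X F z = 2 * K z * dir X K z.
  rewrite /dir mulr_sumr; apply: eq_bigr => a _.
  rewrite pd_Ksq; last by [].
  by move: (pd a K z) => x; ring.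
have K0 := lt0r_neq0 (K_gt0 Dz).
move: E; rewrite dir_Ksq // => E; split=> [X0|X0].
  move: E; rewrite X0 mulr0 => /eqP; rewrite mulf_eq0 pnatr_eq0 /= => /eqP E.
  by rewrite [LHS]mx11_scalar E raddf0.
move: E; rewrite X0 mxE mulr0 => /esym/eqP.
by rewrite !mulf_eq0 pnatr_eq0 (negPf K0) /= => /eqP.
Qed.

Lemma inner_xi X z : D z ->
  inner (sasaki_mx K) X (xi K) z = (hor X z *m (rsubmx z)^T) 0 0.
Proof.
move=> Dz; rewrite inner_sasaki ver_xi // hor_xi trmx0 mulmx0 addr0.
by rewrite -mulmxA glo_Pup.
Qed.

(** Since p^i is annihilated on both sides of the matrix, a basis vector may be replaced by its
    projection along p^i onto the vectors that pair to zero with p, where the hypothesis applies. *)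
Lemma angular_mx_eq0 z : D z ->
  (forall u v : 'rV[R]_n, u *m (rsubmx z)^T = 0 -> v *m (Pup z)^T = 0 ->
     u *m angular_mx z *m Gup z *m v^T = 0) ->
  angular_mx z = 0.
Proof.
move=> Dz H.
pose proj (u : 'rV[R]_n) := u - ((u *m (rsubmx z)^T) 0 0 / F z) *: Pup z.
have projP u : proj u *m (rsubmx z)^T = 0.
  rewrite mulmxBl -scalemxAl rsubmx_PupC // scale_scalar_mx divfK ?Ksq_neq0 //.
  by rewrite [X in X - _]mx11_scalar subrr.
have projL u : proj u *m angular_mx z = u *m angular_mx z.
  by rewrite mulmxBl -scalemxAl Pup_angular_mx // scaler0 subr0.
have projR u : angular_mx z *m (proj u)^T = angular_mx z *m u^T.
  by rewrite trmxD trmxN linearZ /= mulmxDr mulmxN -scalemxAr angular_mx_Pup // scaler0 subr0.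
apply/matrixP => i j; rewrite [RHS]mxE.
(* Lowering the second projected vector by g turns its pairing with p^i into one with p, so that
   [projP] applies; the factor [Gup] then undoes the lowering. *)
have := H (proj (delta_mx 0 i)) (proj (delta_mx 0 j) *m Glo z) (projP _).
rewrite -mulmxA glo_Pup // => /(_ (projP _)).
rewrite trmx_mul glo_sym // -[_ *m Gup z *m _]mulmxA [Gup z *m _]mulmxA gupK // mul1mx.
rewrite -mulmxA projR mulmxA projL trmx_delta -rowE -colE.
by move=> /matrixP/(_ 0 0); rewrite !mxE.
Qed.

(* [w |-> fiber_scale (c / K w) w] retracts the slit bundle onto [K = c], and its
   derivative at a point of [K = c] fixes the tangent vectors. *)
Lemma dir_eq0_level (c : R) f X z : 0 < c -> D z -> K z = c -> differentiable f z ->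
  (forall w, D w -> K w = c -> f w = 0) -> dir X K z = 0 -> dir X f z = 0.
Proof.
move=> c0 Dz Kz df f0 X0.
pose rho w := fiber_scale (c / K w) w.
have dK := smooth_diff sK Dz; have K0 : K z != 0 by rewrite gt_eqF ?K_gt0.
have rz : rho z = z.
  by rewrite /rho Kz divff ?gt_eqF // /fiber_scale scale1r hsubmxK.
have frho w : D w -> f (rho w) = 0.
  move=> Dw; have t0 : 0 < c / K w by rewrite divr_gt0 ?K_gt0.
  by apply: f0; [exact: homD|rewrite homK // divfK ?gt_eqF ?K_gt0].
have dcK : differentiable (fun w => c / K w) z.
  by apply: differentiable_funM => //; exact: differentiableV.
have rE : rho = fun w => row_mx (lsubmx w) ((c / K w) *: rsubmx w) by [].
have rho_l i : (fun w => rho w 0 (lshift n i)) = (fun w => w 0 (lshift n i)).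
  by rewrite funeqE => w; rewrite rE row_mxEl mxE.
have rho_r i : (fun w => rho w 0 (rshift n i)) = (fun w => c / K w * w 0 (rshift n i)).
  by rewrite funeqE => w; rewrite rE row_mxEr scalemxE mxE.
have drho : differentiable rho z.
  apply: differentiable_row => b; case: (split_ordP b) => i ->.
    by rewrite rho_l; exact: differentiable_coordr.
  by rewrite rho_r; apply: differentiable_funM => //; exact: differentiable_coordr.
have dir_rho b : dir X (fun w => rho w 0 b) z = X z 0 b.
  case: (split_ordP b) => i ->; first by rewrite rho_l dir_coord.
  rewrite rho_r dirM ?dir_coord //; last exact: differentiable_coordr.
  rewrite dirM ?dir_cst ?dirV // ?X0; last exact: differentiableV.
  by rewrite Kz divff ?gt_eqF // !mul0r oppr0 mulr0 addr0 mul0r add0r mul1r.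
have : dir X (fun w => f (rho w)) z = 0.
  by rewrite (near_eq_dir _ (near_eq_dom Dz frho)) dir_cst.
rewrite /dir; under eq_bigr => a _ do rewrite pd_comp ?rz // mulr_sumr.
rewrite exchange_big => H; rewrite -[RHS]H; apply: eq_bigr => b _ /=.
rewrite -dir_rho /dir mulr_suml; apply: eq_bigr => a _.
by rewrite -mulrA [pd b f z * _]mulrC.
Qed.

(** * Fields tangent to the level sets and orthogonal to [xi] *)

Lemma xi_smooth : smooth_map D (xi K).
Proof.
move=> b; under eq_fun do rewrite xiE.
case: (split_ordP b) => i ->.
  by under eq_fun do rewrite row_mxEl; exact: Pup_smooth.
under eq_fun do rewrite row_mxEr.
by apply: smooth_mulmx => //; [exact: Pup_smooth|exact: Nmx_smooth].
Qed.

Lemma dir_xi_K z : D z -> dir (xi K) K z = 0.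
Proof. by move=> Dz; apply/dir_K_eq0 => //; rewrite ver_xi // mul0mx. Qed.

(* Subtracting multiples of the Liouville field [p_i d/dp_i] and of [xi] makes a
   constant vector tangent to the level sets of [K] and orthogonal to [xi]. *)
Definition tangent_field (w0 : 'rV[R]_(n + n)) z : 'rV[R]_(n + n) :=
  w0 - (dir (fun=> w0) K z / K z) *: row_mx 0 (rsubmx z)
     - ((lsubmx w0 *m (rsubmx z)^T) 0 0 / F z) *: xi K z.

Lemma tangent_field_smooth w0 : smooth_map D (tangent_field w0).
Proof.
have sF := Ksq_smooth.
have KV : smooth D (fun z => (K z)^-1).
  by apply: smoothV => // z Dz; rewrite gt_eqF ?K_gt0.
have FV : smooth D (fun z => (F z)^-1).
  by apply: smoothV => // z Dz; exact: Ksq_neq0.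
move=> b; under eq_fun do rewrite /tangent_field addmxE addmxE !oppmxE !scalemxE.
apply: smoothB => //; last first.
  apply: smoothM => //; last exact: xi_smooth.
  apply: smoothM => //; under eq_fun do rewrite mxE.
  apply: smooth_sum => // i _; apply: smoothM => //; first exact: smooth_cst.
  by under eq_fun do rewrite !mxE; exact: smooth_coord.
apply: smoothB => //; first exact: smooth_cst.
apply: smoothM => //.
  apply: smoothM => //; apply: smooth_sum => // a _; apply: smoothM => //.
    exact: smooth_cst.
  exact: smooth_pd.
case: (split_ordP b) => i ->.
  by under eq_fun do rewrite row_mxEl mxE; exact: smooth_cst.
by under eq_fun do rewrite row_mxEr mxE; exact: smooth_coord.
Qed.

(** By Euler's relation the Liouville field derives K to K, and [xi] derives it to 0, so the first
    correction removes exactly the derivative along w0. *)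
Lemma dir_tangent_field w0 z : D z -> dir (tangent_field w0) K z = 0.
Proof.
move=> Dz; have dK := smooth_diff sK Dz; have K0 := lt0r_neq0 (K_gt0 Dz).
have dL : 'd K z (row_mx 0 (rsubmx z)) = K z.
  rewrite -[RHS]euler_K // diff_pd // big_split_ord /= big1 ?add0r => [|i _]; last first.
    by rewrite row_mxEl mxE mul0r.
  by apply: eq_bigr => i _; rewrite row_mxEr.
have dX : 'd K z (xi K z) = 0 by rewrite -dirE ?dir_xi_K.
rewrite dirE // /tangent_field !linearB !linearZ /= dX dL (dirE _ dK).
by rewrite oppr0 /GRing.scale /= mulr0 addr0 mulrN divfK // subrr.
Qed.

(** The Liouville field has no base part, and p_i p^i = K^2 fixes the coefficient of [xi]. *)
Lemma tangent_field_base w0 z : D z ->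
  lsubmx (tangent_field w0 z) *m (rsubmx z)^T = 0.
Proof.
move=> Dz; rewrite /tangent_field -[X in lsubmx (X - _ - _)](hsubmxK w0) xiE.
rewrite !scale_row_mx !opp_row_mx !add_row_mx row_mxKl scaler0 subr0.
rewrite mulmxBl -scalemxAl rsubmx_PupC // scale_scalar_mx.
rewrite divfK ?Ksq_neq0 //.
by rewrite [X in X - _]mx11_scalar subrr.
Qed.

Lemma tangent_field_id w0 z : dir (fun=> w0) K z = 0 ->
  lsubmx w0 *m (rsubmx z)^T = 0 -> tangent_field w0 z = w0.
Proof.
by move=> d0 b0; rewrite /tangent_field d0 b0 mxE !mul0r !scale0r !subr0.
Qed.

(** * Homogeneity in the momenta *)

Section Homogeneity.
Variable t : R.
Hypothesis t_gt0 : 0 < t.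
Local Notation sigma := (fiber_scale t).

(** Homogeneity for one fixed dilation, recorded by its factor rather than by a degree: a derivative
    in x keeps the factor and a derivative in p divides it by t. *)
Definition scales_by (c : R) f := forall z, D z -> f (sigma z) = c * f z.

Lemma scales_eq c c' f : c = c' -> scales_by c f -> scales_by c' f.
Proof. by move=> ->. Qed.

Lemma scales_cst c : scales_by 1 (fun=> c).
Proof. by move=> z _; rewrite mul1r. Qed.

Lemma scalesD c f h : scales_by c f -> scales_by c h -> scales_by c (fun z => f z + h z).
Proof. by move=> sf sh z Dz; rewrite sf // sh // mulrDr. Qed.

Lemma scalesB c f h : scales_by c f -> scales_by c h -> scales_by c (fun z => f z - h z).
Proof. by move=> sf sh z Dz; rewrite sf // sh // mulrBr. Qed.

Lemma scalesM c c' f h : scales_by c f -> scales_by c' h ->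
  scales_by (c * c') (fun z => f z * h z).
Proof. by move=> sf sh z Dz; rewrite sf // sh // mulrACA. Qed.

Lemma scales_sum c (f : 'I_n -> 'rV[R]_(n + n) -> R) :
  (forall i, scales_by c (f i)) -> scales_by c (fun z => \sum_i f i z).
Proof. by move=> sf z Dz; rewrite mulr_sumr; apply: eq_bigr => i _; exact: sf. Qed.

Lemma scales_pd c f a z : smooth D f -> scales_by c f -> D z ->
  pd a (fun w => f (sigma w)) z = c * pd a f z.
Proof.
move=> sf hf Dz; rewrite (near_eq_pd a (near_eq_dom Dz hf)) !pd_dir dirZ //.
exact: smooth_diff sf Dz.
Qed.

Lemma scales_pdx c f i : smooth D f -> scales_by c f -> scales_by c (pdx i f).
Proof.
move=> sf hf z Dz; rewrite /pdx -(scales_pd _ sf hf Dz).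
by rewrite [RHS]derive_lin_comp /= fiber_scale_base.
Qed.

Lemma scales_pdp c f i : smooth D f -> scales_by c f -> scales_by (c / t) (pdp i f).
Proof.
move=> sf hf z Dz; rewrite /pdp mulrAC -(scales_pd _ sf hf Dz).
have df : differentiable f (sigma z) by apply: smooth_diff sf _; exact: homD.
rewrite [X in _ = X / t]derive_lin_comp /= fiber_scale_fiber deriveE // linearZ /=.
by rewrite -pdE // [_ *: _]mulrC mulfK ?gt_eqF.
Qed.

Lemma scales_Ksq : scales_by (t ^+ 2) F.
Proof. by move=> z Dz; rewrite /Ksq homK // exprMn. Qed.

Let t_neq0 : t != 0. Proof. by rewrite gt_eqF. Qed.

Lemma gup_scale z : D z -> Gup (sigma z) = Gup z.
Proof.
move=> Dz; apply/matrixP => i j; rewrite [LHS]mxE [RHS]mxE; apply: (congr1 ( *%R 2^-1)).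
have e : t ^+ 2 / t / t = 1 by field.
have sp := pdp_smooth j Ksq_smooth.
have H := scales_eq e (scales_pdp i sp (scales_pdp j Ksq_smooth scales_Ksq)).
by rewrite (H z Dz) mul1r.
Qed.

Lemma scales_glo i j : scales_by 1 (fun z => Glo z i j).
Proof. by move=> z Dz; rewrite mul1r /glo gup_scale. Qed.

Lemma scales_momentum i : scales_by t (fun z => momentum z i).
Proof. by move=> z Dz; rewrite /momentum /fiber_scale row_mxKr mxE. Qed.

Lemma scales_Ncoef i j : scales_by t (Ncoef K i j).
Proof.
have sF := Ksq_smooth; have sg := glo_smooth.
have e1 : t ^+ 2 / t = t by rewrite expr2 mulfK.
apply: scalesB.
  apply: (scales_eq (mul1r t)); apply: scalesM; first exact: scales_cst.
  apply: scales_sum => k; apply: scalesB.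
    apply: (@scales_eq (1 / t * t ^+ 2)); first by field.
    apply: scalesM; first exact: scales_pdp (sg i j) (scales_glo i j).
    exact: scales_pdx sF scales_Ksq.
  apply: (@scales_eq (t ^+ 2 / t * 1)); first by rewrite mulr1.
  by apply: scalesM; [exact: scales_pdp sF scales_Ksq|exact: scales_pdx (sg i j) (scales_glo i j)].
have spx k l : scales_by t (pdp k (pdx l F)).
  apply: (scales_eq e1); apply: scales_pdp; first exact: pdx_smooth.
  exact: scales_pdx scales_Ksq.
apply: (scales_eq (mul1r t)); apply: scalesM; first exact: scales_cst.
apply: scales_sum => k; apply: scalesD; apply: (scales_eq (mul1r t));
  apply: scalesM; by [exact: scales_glo|exact: spx].
Qed.

(** The coefficients [Ncoef] gain a factor t, which makes up for the factor lost by the derivatives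
    in p. *)
Lemma scales_dir_delta c f i : smooth D f -> scales_by c f ->
  scales_by c (dir (delta K i) f).
Proof.
move=> sf hf.
have E z : dir (delta K i) f z = pdx i f z + \sum_j Ncoef K i j z * pdp j f z.
  rewrite dir_split deltaE; congr (_ + _).
    rewrite (bigD1 i) //= row_mxEl mxE !eqxx mul1r big1 ?addr0 // => j /negPf ji.
    by rewrite row_mxEl mxE ji andbF mul0r.
  by apply: eq_bigr => j _; rewrite row_mxEr !mxE.
move=> z Dz; rewrite !E; move: z Dz; apply: scalesD; first exact: scales_pdx.
apply: scales_sum => j; apply: (@scales_eq (t * (c / t))); first by field.
by apply: scalesM; [exact: scales_Ncoef|exact: scales_pdp].
Qed.

Lemma scales_Rtensor i j : scales_by (t ^+ 2) (Rtensor K i j).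
Proof.
apply: scales_sum => h; apply: scales_sum => k.
rewrite expr2; apply: scalesM.
  rewrite -[X in scales_by X _]mulr1; apply: scalesM; first exact: scales_momentum.
  by move=> z Dz; rewrite mul1r gup_scale.
by apply: scalesB; apply: scales_dir_delta; [exact: Ncoef_smooth|exact: scales_Ncoef
  |exact: Ncoef_smooth|exact: scales_Ncoef].
Qed.

Lemma scales_angular_metric i j : scales_by 1 (angular_metric K i j).
Proof.
move=> z Dz; rewrite /angular_metric.
have := scales_momentum j Dz; have := scales_momentum i Dz; rewrite /= => Ei Ej.
rewrite Ej Ei (scales_Ksq Dz) mul1r.
have -> : glo K (sigma z) = Glo z by rewrite /glo gup_scale.
have := Ksq_neq0 Dz; move: (F z) (Glo z i j) (momentum z i) (momentum z j) => x y u v x0.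
by field; rewrite t_neq0 x0.
Qed.

End Homogeneity.

End LocalCartan.

(** * A smooth function flat at the origin *)

Section Flat.
Context {R : realType}.
Implicit Types (s x : R).

(* The factors [s^-1] make the family stable under derivation. *)
Definition flat (j : nat) s : R := if 0 < s then s^-1 ^+ j * expR (- s^-1) else 0.

Lemma flat_le0 j s : s <= 0 -> flat j s = 0.
Proof. by rewrite /flat ltNge => ->. Qed.

Lemma flat_ge0 j s : 0 <= flat j s.
Proof.
rewrite /flat; case: ifPn => // s0.
by rewrite mulr_ge0 ?expR_ge0 // exprn_ge0 // invr_ge0 ltW.
Qed.

(** From exp(u) >= u^(j+1) / (j+1)! with u = 1/s. The bound makes every [flat j] tend to 0 at the
    origin. *)
Lemma flat_lin_bound j s : flat j s <= (j.+1)`!%:R * `|s|.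
Proof.
rewrite /flat; case: ifPn => [s0|_]; last by rewrite mulr_ge0.
rewrite gtr0_norm // expRN ler_pdivrMr ?expR_gt0 //.
have u0 : 0 < s^-1 by rewrite invr_gt0.
have := expR_ge1Dxn j (ltW u0); set E := expR _; set f := _%:R => H.
have f0 : 0 < f by rewrite ltr0n fact_gt0.
have : s^-1 ^+ j.+1 <= f * E.
  rewrite mulrC -ler_pdivrMr //; apply: le_trans H.
  by rewrite lerDr ler01.
rewrite exprSr ler_pdivrMr // => H'; apply: le_trans H' _.
by rewrite mulrAC.
Qed.

Lemma flatS j s : flat j.+1 s = s^-1 * flat j s.
Proof. by rewrite /flat; case: ifP; rewrite ?mulr0 // exprS mulrA. Qed.

Lemma is_derive_flat j s :
  is_derive s (1 : R) (flat j) (flat j.+2 s - j%:R * flat j.+1 s).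
Proof.
have [s0|s0|->] := ltgtP s 0.
- rewrite !flat_le0 ?ltW // mulr0 subr0.
  apply: (@near_eq_is_derive _ _ _ (cst 0)).
  near=> x; rewrite flat_le0 // ltW //.
  by near: x; exact: lt_nbhsl.
- pose G (u : R) := u ^+ j * expR (- u).
  apply: (@near_eq_is_derive _ _ _ (G \o GRing.inv)).
    near=> x; rewrite /flat ifT //=.
    by near: x; exact: lt_nbhsr.
  have di : is_derive s (1 : R) GRing.inv (- (s ^- 2)).
    have := @is_deriveV R id s 1 1 (lt0r_neq0 s0) (is_derive_id _ _).
    by rewrite [_ *: _]mulr1.
  have dG : is_derive s^-1 (1 : R) G
     (j%:R * s^-1 ^+ j.-1 * expR (- s^-1) - s^-1 ^+ j * expR (- s^-1)).
    have dN : is_derive s^-1 (1 : R) (fun u : R => - u) (-1) by exact: is_deriveNid.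
    have dE : is_derive s^-1 (1 : R) (fun u : R => expR (- u)) (expR (- s^-1) * -1).
      by apply: (@is_derive1_comp _ expR (fun u : R => - u)).
    have dX : is_derive s^-1 (1 : R) (fun u : R => u ^+ j) (j%:R * s^-1 ^+ j.-1).
      apply: DeriveDef; first exact: exprn_derivable.
      by rewrite exp_derive /GRing.scale /= mulr1.
    have := is_deriveM dX dE; rewrite /GRing.scale /= => H.
    by apply: is_derive_eq H _; ring.
  have := @is_derive1_comp _ _ _ _ _ _ dG di.
  move=> H; apply: is_derive_eq H _; rewrite /flat s0 -exprVn.
  (* The case j = 0 is separate because of [j.-1]; its term carries the factor j. *)
  case: (j) => [|k]; first by rewrite /= !expr0 expr2; ring.
  by rewrite /= !exprS; ring.
- rewrite !flat_le0 // mulr0 subr0.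
  (* The difference quotient at 0 is [flat j.+1] itself; at h = 0 both sides are 0 since the inverse
     of 0 is 0. *)
  have E : (fun h : R => h^-1 *: ((flat j \o shift 0) (h *: (1 : R)) - flat j 0)) =
           flat j.+1.
    rewrite funeqE => h /=; rewrite addr0 (flat_le0 _ (lexx 0)) subr0 flatS.
    by rewrite [h *: 1]mulr1.
  have L : (flat j.+1 @ 0^') --> (0 : R).
    apply/cvgr0Pnorm_le => e e0; near=> h.
    rewrite ger0_norm ?flat_ge0 //; apply: le_trans (flat_lin_bound _ _) _.
    rewrite mulrC -ler_pdivlMr ?ltr0n ?fact_gt0 //.
    by near: h; apply: dnbhs0_le; rewrite divr_gt0 // ltr0n fact_gt0.
  apply: DeriveDef; first by rewrite /derivable E; apply/cvg_ex; exists 0.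
  by rewrite /derive E; exact: cvg_lim.
Unshelve. all: by end_near. Qed.

Lemma differentiable_flat j s : differentiable (flat j) s.
Proof. by apply/derivable1_diffP; have [] := is_derive_flat j s. Qed.

Lemma pd_flat_comp (m j : nat) (q : 'rV[R]_m -> R) a (z : 'rV[R]_m) :
  differentiable q z ->
  pd a (fun w => flat j (q w)) z =
  (flat j.+2 (q z) - j%:R * flat j.+1 (q z)) * pd a q z.
Proof.
move=> dq; have df := differentiable_flat j (q z).
rewrite !pdE //; last exact: (differentiable_comp dq df).
etransitivity; first exact: (congr1 (@^~ (delta_mx 0 a)) (diff_comp dq df)).
rewrite /= diff1E // [LHS]mulrC derive1E.
by have [_ ->] := is_derive_flat j (q z).
Qed.

Lemma smooth_flat (m j : nat) (D : set 'rV[R]_m) (q : 'rV[R]_m -> R) :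
  open D -> smooth D q -> smooth D (fun z => flat j (q z)).
Proof.
move=> oD sq k; elim: k j => [|k IH] j.
  move=> z Dz; apply: differentiable_continuous.
  exact: (differentiable_comp (smooth_diff sq Dz) (differentiable_flat j (q z))).
split=> [z Dz|a].
  exact: (differentiable_comp (smooth_diff sq Dz) (differentiable_flat j (q z))).
apply: (@Cn_ext _ _ _ _ (fun z => (flat j.+2 (q z) + (- j%:R) * flat j.+1 (q z)) * pd a q z)) => //.
  move=> z Dz; rewrite pd_flat_comp ?mulNr //; exact: smooth_diff sq Dz.
apply: CnM => //; last exact: smooth_pd sq k.
by apply: CnD => //; apply: CnM => //; exact: Cn_cst.
Qed.

End Flat.

(** * Changes of charts on M and on its cotangent bundle *)

Lemma open_preimage_at (T U : topologicalType) (A : set T) (B : set U) (f : T -> U) :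
  open A -> open B -> (forall x, A x -> {for x, continuous f}) ->
  open [set x | A x /\ B (f x)].
Proof.
move=> oA oB cf; rewrite openE => x [Ax Bx]; apply: filterI.
  exact: open_nbhs_nbhs.
by apply: (cf x Ax); exact: open_nbhs_nbhs.
Qed.

Lemma jacobian_comp (R : realType) (m l p : nat) (f : 'rV[R]_m -> 'rV[R]_l)
    (g : 'rV[R]_l -> 'rV[R]_p) z :
  differentiable f z -> differentiable g (f z) ->
  'J (fun w => g (f w)) z = 'J f z *m 'J g (f z).
Proof.
move=> df dg; apply/matrixP => a c; rewrite [RHS]mxE jacobianE; last first.
  exact: (differentiable_comp df dg).
have dgc := differentiable_row_coord c dg.
rewrite (@pd_comp _ _ _ (fun u => g u 0 c) f z a df dgc).
by apply: eq_bigr => b _; rewrite !jacobianE // mulrC.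
Qed.

Lemma near_eq_jacobian (R : realType) (m l : nat) (f g : 'rV[R]_m -> 'rV[R]_l) z :
  (\forall w \near z, f w = g w) -> differentiable g z -> 'J f z = 'J g z.
Proof.
move=> fg dg; apply/matrixP => a b.
have df := near_eq_differentiable fg dg.
rewrite [LHS](jacobianE a b df) [RHS](jacobianE a b dg).
by apply: near_eq_pd; apply: filterS fg => w ->.
Qed.

Lemma jacobian_id (R : realType) (m : nat) (z : 'rV[R]_m) : 'J (fun w => w) z = 1%:M.
Proof.
apply/matrixP => a b; by rewrite jacobianE ?pd_coord ?mxE.
Qed.

Lemma smooth_map_diff (R : realType) (m l : nat) (D : set 'rV[R]_m)
    (f : 'rV[R]_m -> 'rV[R]_l) z : smooth_map D f -> D z -> differentiable f z.
Proof. by move=> sf Dz; apply: differentiable_row => b; exact: smooth_diff (sf b) Dz. Qed.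

(* [coord] and [coord_continuous] are also names of the libraries imported after
   [Defs]. *)
Import Defs.

Section Transitions.
Context {R : realType} {n : nat} {M : smooth_manifold R n}.
Implicit Types (a b c : chart M) (x : 'rV[R]_n) (z : 'rV[R]_(n + n)).

Definition overlap a b : set 'rV[R]_n :=
  [set x | (coord a @` chart_dom a) x /\ chart_dom b (param a x)].

Lemma param_dom a x : (coord a @` chart_dom a) x -> chart_dom a (param a x).
Proof. by move=> [q dq <-]; rewrite coordK. Qed.

Lemma paramK a x : (coord a @` chart_dom a) x -> coord a (param a x) = x.
Proof. by move=> [q dq <-]; rewrite coordK. Qed.

Lemma overlap_open a b : open (overlap a b).
Proof.
apply: open_preimage_at; [exact: coord_open|exact: chart_dom_open|].
exact: param_continuous.
Qed.

Lemma overlapE a b : overlap a b = coord a @` (chart_dom a `&` chart_dom b).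
Proof.
apply/seteqP; split=> x.
  move=> [ax bx]; exists (param a x); first by split=> //; exact: param_dom.
  exact: paramK.
by move=> [q [aq bq] <-]; split; [exists q|rewrite coordK].
Qed.

Lemma transition_smooth_overlap a b : smooth_map (overlap a b) (transition a b).
Proof. by rewrite overlapE; exact: transition_smooth. Qed.

Lemma overlap_id a x : (coord a @` chart_dom a) x -> overlap a a x.
Proof. by move=> ax; split=> //; exact: param_dom. Qed.

Lemma param_transition a b x : overlap a b x -> param b (transition a b x) = param a x.
Proof. by move=> [ax bx]; rewrite /transition coordK. Qed.

Lemma overlap_transition a b c x : overlap a b x -> chart_dom c (param a x) ->
  overlap b c (transition a b x).
Proof.
move=> abx cx; split; last by rewrite param_transition.
by exists (param a x) => //; case: abx.
Qed.

Lemma overlap_sym a b x : overlap a b x -> overlap b a (transition a b x).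
Proof. by move=> abx; apply: overlap_transition => //; apply: param_dom; case: abx. Qed.

Lemma transition_comp a b c x : overlap a b x ->
  transition b c (transition a b x) = transition a c x.
Proof. by move=> abx; rewrite {1}/transition param_transition. Qed.

Lemma transition_id a x : (coord a @` chart_dom a) x -> transition a a x = x.
Proof. exact: paramK. Qed.

Lemma transition_diff a b x : overlap a b x -> differentiable (transition a b) x.
Proof. exact: smooth_map_diff (transition_smooth_overlap a b). Qed.

Lemma jacobian_transition_comp a b c x : overlap a b x -> overlap a c x ->
  'J (transition a b) x *m 'J (transition b c) (transition a b x) =
  'J (transition a c) x.
Proof.
move=> abx acx; have bcx := overlap_transition abx acx.2.
rewrite -jacobian_comp; [|exact: transition_diff|exact: transition_diff].
apply: near_eq_jacobian; last exact: transition_diff.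
by apply: (open_near (@overlap_open a b) abx) => w; exact: transition_comp.
Qed.

Lemma jacobian_transition_id a x : (coord a @` chart_dom a) x ->
  'J (transition a a) x = 1%:M.
Proof.
move=> ax; rewrite -(jacobian_id x); apply: near_eq_jacobian.
  by apply: (open_near (@coord_open _ _ M a) ax) => w; exact: transition_id.
by apply: differentiable_row => c; exact: differentiable_coordr.
Qed.

Lemma jacobian_transitionK a b x : overlap a b x ->
  'J (transition a b) x *m 'J (transition b a) (transition a b x) = 1%:M.
Proof.
move=> abx; have ax := abx.1.
by rewrite jacobian_transition_comp ?jacobian_transition_id //; exact: overlap_id.
Qed.

(** The inverse in [ct_transition] becomes a Jacobian of the reverse transition, so that smoothness
    and the cocycle rule follow from those of the transition maps. *)
Lemma invmx_jacobian_transition a b x : overlap a b x ->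
  invmx ('J (transition a b) x)^T = ('J (transition b a) (transition a b x))^T.
Proof.
move=> abx; have H := jacobian_transitionK abx.
have H' : ('J (transition b a) (transition a b x))^T *m ('J (transition a b) x)^T = 1%:M.
  by rewrite -trmx_mul H trmx1.
have [_ u] := mulmx1_unit H'.
by rewrite -[RHS](mulmxK u) H' mul1mx.
Qed.

Definition ct_overlap a b : set 'rV[R]_(n + n) := [set z | overlap a b (lsubmx z)].

Lemma ct_overlap_open a b : open (ct_overlap a b).
Proof.
apply: open_comp; last exact: overlap_open.
by move=> z _; exact: continuous_lsubmx.
Qed.

Lemma ct_transitionE a b z : ct_overlap a b z -> ct_transition a b z =
  row_mx (transition a b (lsubmx z))
    (rsubmx z *m ('J (transition b a) (transition a b (lsubmx z)))^T).
Proof. by move=> abz; rewrite /ct_transition invmx_jacobian_transition. Qed.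

Lemma lsubmx_ct a b z : lsubmx (ct_transition a b z) = transition a b (lsubmx z).
Proof. by rewrite row_mxKl. Qed.

Lemma ct_overlap_transition a b c z : ct_overlap a b z -> ct_overlap a c z ->
  ct_overlap b c (ct_transition a b z).
Proof.
by move=> abz [_ acz]; rewrite /ct_overlap /= lsubmx_ct; exact: overlap_transition.
Qed.

Lemma basept_ct a b z : ct_overlap a b z -> basept b (ct_transition a b z) = basept a z.
Proof. by move=> abz; rewrite /basept lsubmx_ct param_transition. Qed.

(** On the momenta this is the chain rule for the reverse transitions, from c through b to a. *)
Lemma ct_transition_comp a b c z : ct_overlap a b z -> ct_overlap a c z ->
  ct_transition b c (ct_transition a b z) = ct_transition a c z.
Proof.
move=> abz acz; have bcz := ct_overlap_transition abz acz.
have tc : transition b c (transition a b (lsubmx z)) = transition a c (lsubmx z).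
  exact: (transition_comp c abz).
apply: etrans (ct_transitionE bcz) _; rewrite lsubmx_ct.
apply: etrans (congr1 (fun w => row_mx w (_ *m ('J (transition c b) w)^T)) tc) _.
apply: etrans _ (esym (ct_transitionE acz)); apply: (congr1 (row_mx _)).
have := jacobian_transition_comp (overlap_transition acz abz.2) (overlap_sym acz).
rewrite (transition_comp b acz) => E.
apply: etrans (congr1 (fun J => rsubmx z *m J^T) E).
by rewrite trmx_mul mulmxA [X in rsubmx X](ct_transitionE abz) row_mxKr.
Qed.

Lemma ct_transition_id a z : ct_dom a z -> ct_transition a a z = z.
Proof.
move=> az; rewrite ct_transitionE; last exact: overlap_id.
rewrite transition_id // jacobian_transition_id // trmx1 mulmx1.
by rewrite hsubmxK.
Qed.

Lemma ct_transitionK a b z : ct_overlap a b z ->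
  ct_transition b a (ct_transition a b z) = z.
Proof.
move=> abz; have az : ct_dom a z by case: abz.
by rewrite ct_transition_comp ?ct_transition_id //; exact: overlap_id.
Qed.

Lemma smooth_lsubmx (D : set 'rV[R]_(n + n)) : smooth_map D (@lsubmx R 1 n n).
Proof. by move=> i; under eq_fun do rewrite mxE; exact: smooth_coord. Qed.

Lemma ct_transition_smooth a b : smooth_map (ct_overlap a b) (ct_transition a b).
Proof.
have oab := @ct_overlap_open a b.
have sl := @smooth_lsubmx (ct_overlap a b).
have st i : smooth (ct_overlap a b) (fun z => transition a b (lsubmx z) 0 i).
  apply: (@smooth_comp _ _ _ _ (overlap a b) (fun x => transition a b x 0 i)) => //.
  exact: transition_smooth_overlap.
have sj i j : smooth (ct_overlap a b)
    (fun z => ('J (transition b a) (transition a b (lsubmx z))) i j).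
  apply: (@smooth_comp _ _ _ _ (overlap b a) (fun x => ('J (transition b a) x) i j)
    (fun z => transition a b (lsubmx z))) => //.
    by move=> z; exact: overlap_sym.
  apply: (@smooth_ext _ _ _ (pd i (fun x => transition b a x 0 j))).
  - exact: overlap_open.
  - by move=> x bax; rewrite jacobianE //; exact: transition_diff.
  - exact/smooth_pd/transition_smooth_overlap.
move=> c; apply: (@smooth_ext _ _ _ (fun z => row_mx (transition a b (lsubmx z))
    (rsubmx z *m ('J (transition b a) (transition a b (lsubmx z)))^T) 0 c)) => //.
  by move=> z abz; rewrite ct_transitionE.
case: (split_ordP c) => i ->.
  by under eq_fun do rewrite row_mxEl; exact: st.
under eq_fun do rewrite row_mxEr mxE.
apply: smooth_sum => // k _; apply: smoothM => //.
  by under eq_fun do rewrite mxE; exact: smooth_coord.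
by under eq_fun do rewrite mxE; exact: sj.
Qed.

Lemma ct_transition_diff a b z : ct_overlap a b z -> differentiable (ct_transition a b) z.
Proof. exact: smooth_map_diff (@ct_transition_smooth a b). Qed.

Lemma jacobian_ct_comp a b c z : ct_overlap a b z -> ct_overlap a c z ->
  'J (ct_transition a b) z *m 'J (ct_transition b c) (ct_transition a b z) =
  'J (ct_transition a c) z.
Proof.
move=> abz acz; have bcz := ct_overlap_transition abz acz.
rewrite -jacobian_comp; [|exact: ct_transition_diff|exact: ct_transition_diff].
apply: near_eq_jacobian; last exact: ct_transition_diff.
have o2 : open (ct_overlap a b `&` ct_overlap a c).
  by apply: openI; exact: ct_overlap_open.
apply: (open_near o2 (conj abz acz)) => w [abw acw]; exact: ct_transition_comp.
Qed.

Lemma slit_dom_open a : open (slit_dom a).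
Proof.
have -> : slit_dom a = lsubmx @^-1` (coord a @` chart_dom a) `&` rsubmx @^-1` [set p | p != 0].
  by [].
apply: openI; apply: open_comp.
- by move=> z _; exact: continuous_lsubmx.
- exact: coord_open.
- by move=> z _; exact: continuous_rsubmx.
- have -> : [set p : 'rV[R]_n | p != 0] = ~` [set 0].
    by apply/seteqP; split=> p /= /eqP.
  by apply: closed_openC; exact/accessible_closed_set1/hausdorff_accessible/norm_hausdorff.
Qed.

Lemma slit_dom_ct a b z : slit_dom a z -> ct_overlap a b z -> slit_dom b (ct_transition a b z).
Proof.
move=> [az z0] abz; split.
  by rewrite /ct_dom /= lsubmx_ct; case: (overlap_sym abz).
apply: contraNN z0 => /eqP r0; apply/eqP.
rewrite -(ct_transitionK abz) ct_transitionE; last first.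
  by apply: ct_overlap_transition => //; exact: overlap_id.
by rewrite row_mxKr r0 mul0mx.
Qed.

End Transitions.

Lemma dir_comp (R : realType) (m l : nat) (f : 'rV[R]_l -> R) (h : 'rV[R]_m -> 'rV[R]_l)
    V W z :
  differentiable h z -> differentiable f (h z) -> W (h z) = V z *m 'J h z ->
  dir V (fun w => f (h w)) z = dir W f (h z).
Proof.
move=> dh df WV; rewrite !dirE //; last exact: (differentiable_comp dh df).
etransitivity; first exact: (congr1 (@^~ (V z)) (diff_comp dh df)).
by rewrite /= WV mul_rV_lin1.
Qed.

(** * Extending a field from one chart to the slit cotangent bundle *)

Section Pushforward.
Context {R : realType} {n : nat} {M : smooth_manifold R n}.
Variables (o : chart M) (Y : 'rV[R]_(n + n) -> 'rV[R]_(n + n)) (C : set 'rV[R]_n).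
Hypothesis sY : smooth_map (slit_dom o) Y.
Hypothesis cC : compact C.
Hypothesis Co : C `<=` coord o @` chart_dom o.
Hypothesis YC : forall z, slit_dom o z -> ~ C (lsubmx z) -> Y z = 0.
Implicit Types (a b : chart M) (w z : 'rV[R]_(n + n)).

(** The field Y of the chart o read in the chart b, extended by zero over the points of M outside
    the domain of o. *)
Definition ct_pushforward b w : 'rV[R]_(n + n) :=
  if `[< chart_dom o (basept b w) >] then
    Y (ct_transition b o w) *m 'J (ct_transition o b) (ct_transition b o w)
  else 0.

Lemma ct_pushforwardE b w : chart_dom o (basept b w) -> ct_pushforward b w =
  Y (ct_transition b o w) *m 'J (ct_transition o b) (ct_transition b o w).
Proof. by rewrite /ct_pushforward; case: asboolP. Qed.

Lemma ct_pushforward_out b w : ~ chart_dom o (basept b w) -> ct_pushforward b w = 0.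
Proof. by rewrite /ct_pushforward; case: asboolP. Qed.

Lemma ct_pushforward_compat a b z : slit_dom a z -> chart_dom b (basept a z) ->
  ct_pushforward b (ct_transition a b z) = ct_pushforward a z *m 'J (ct_transition a b) z.
Proof.
move=> az bz; have abz : ct_overlap a b z by split=> //; case: az.
have [oz|noz] := pselect (chart_dom o (basept a z)); last first.
  by rewrite !ct_pushforward_out ?mul0mx // basept_ct.
have aoz : ct_overlap a o z by split=> //; case: az.
have ob : chart_dom o (basept b (ct_transition a b z)) by rewrite basept_ct.
have oaz := ct_overlap_transition aoz (overlap_id abz.1).
have obz := ct_overlap_transition aoz abz.
apply: etrans (ct_pushforwardE ob) _.
apply: etrans (congr1 (fun u => Y u *m 'J (ct_transition o b) u) (ct_transition_comp abz aoz)) _.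
apply: etrans _ (esym (congr1 (mulmx^~ _) (ct_pushforwardE oz))).
rewrite -mulmxA; apply: (congr1 (mulmx _)); apply/esym.
apply: etrans _ (jacobian_ct_comp oaz obz).
exact: (congr1 (fun u => _ *m 'J (ct_transition a b) u) (esym (ct_transitionK aoz))).
Qed.

(** A compact subset of the Hausdorff space M is closed; over its open complement the extended field
    is zero, which gives smoothness at the points outside the chart o. *)
Lemma support_closed : closed (param o @` C).
Proof.
apply: compact_closed; first exact: manifold_hausdorff.
apply: continuous_compact => //; apply: continuous_in_subspaceT => x.
by rewrite inE => /Co; exact: param_continuous.
Qed.

Lemma basept_continuous b w : slit_dom b w -> {for w, continuous (basept b)}.
Proof.
move=> [bw _]; apply: continuous_comp; first exact: continuous_lsubmx.
exact: param_continuous.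
Qed.

Lemma ct_pushforward_smooth b : smooth_map (slit_dom b) (ct_pushforward b).
Proof.
move=> c; apply: smooth_local => w bw.
have [ow|now] := pselect (chart_dom o (basept b w)).
  pose U := slit_dom b `&` ct_overlap b o.
  have oU : open U by apply: openI; [exact: slit_dom_open|exact: ct_overlap_open].
  exists U; split; first by split=> //; split=> //; case: bw.
  pose E := slit_dom o `&` ct_overlap o b.
  have oE : open E by apply: openI; [exact: slit_dom_open|exact: ct_overlap_open].
  have UE z : U z -> E (ct_transition b o z).
    move=> [bz boz]; split; first exact: slit_dom_ct.
    by apply: ct_overlap_transition => //; exact: overlap_id boz.1.
  apply: (@smooth_ext _ _ _ (fun z => (Y (ct_transition b o z) *m
      'J (ct_transition o b) (ct_transition b o z)) 0 c)) => //.
    by move=> z [bz boz]; rewrite ct_pushforwardE //; case: boz.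
  apply: (@smooth_comp _ _ _ _ E (fun u => (Y u *m 'J (ct_transition o b) u) 0 c)
    (ct_transition b o) oU UE).
    move=> d; apply: (@smooth_subset _ _ (ct_overlap b o)); first by move=> z [].
    exact: ct_transition_smooth.
  apply: smooth_mulmx => //.
    move=> i j; rewrite ord1; apply: (@smooth_subset _ _ (slit_dom o)).
      by move=> z [].
    exact: sY.
  move=> i j; apply: (@smooth_ext _ _ _ (pd i (fun u => ct_transition o b u 0 j))) => //.
    by move=> z [_ obz]; rewrite jacobianE //; exact: ct_transition_diff.
  apply: smooth_pd; apply: (@smooth_subset _ _ (ct_overlap o b)); first by move=> z [].
  exact: ct_transition_smooth.
(* This neighbourhood may still meet the chart o; there Y vanishes because the base point avoids
   C. *)
pose U := [set z | slit_dom b z /\ (~` (param o @` C)) (basept b z)].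
have oU : open U.
  apply: open_preimage_at; [exact: slit_dom_open| |exact: basept_continuous].
  by apply: closed_openC; exact: support_closed.
exists U; split.
  split=> // -[x Cx xw]; apply: now; rewrite -xw.
  by apply: param_dom; exact: Co.
apply: (@smooth_ext _ _ _ (fun=> 0)) => //; last exact: smooth_cst.
move=> z [bz nCz]; have [oz|noz] := pselect (chart_dom o (basept b z)); last first.
  by rewrite ct_pushforward_out // mxE.
have boz : ct_overlap b o z by split=> //; case: bz.
rewrite ct_pushforwardE // YC ?mul0mx ?mxE //; first exact: slit_dom_ct.
rewrite lsubmx_ct => Cz; apply: nCz; exists (transition b o (lsubmx z)) => //.
exact: param_transition.
Qed.

Lemma ct_pushforward_chart z : slit_dom o z -> ct_pushforward o z = Y z.
Proof.
move=> oz; have ooz : ct_overlap o o z by apply: overlap_id; case: oz.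
rewrite ct_pushforwardE; last by case: ooz.
rewrite ct_transition_id; last by case: oz.
suff -> : 'J (ct_transition o o) z = 1%:M by rewrite mulmx1.
rewrite -(jacobian_id z); apply: near_eq_jacobian.
  apply: (open_near (@slit_dom_open _ _ M o) oz) => w [ow _].
  exact: ct_transition_id.
by apply: differentiable_row => c; exact: differentiable_coordr.
Qed.

Lemma mul_jacobian_lsubmx (v z : 'rV[R]_(n + n)) :
  v *m 'J (@lsubmx R 1 n n) z = lsubmx v.
Proof.
have dl : differentiable (@lsubmx R 1 n n) z by exact: differentiable_lsubmx.
apply/matrixP => i j; rewrite ord1 {i} [LHS]mxE.
rewrite [RHS]mxE [in RHS](row_sum_delta v) summxE; apply: eq_bigr => k _.
rewrite (jacobianE _ _ dl); under eq_fun do rewrite mxE.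
by rewrite pd_coord !mxE eqxx /= eq_sym.
Qed.

Hypothesis Ybase : forall z, slit_dom o z -> lsubmx (Y z) *m (rsubmx z)^T = 0.

(** The pairing is the Liouville form: a change of chart multiplies the base part by a Jacobian and
    the momentum by the inverse transpose, so the value is the same in every chart. *)
Lemma ct_pushforward_base b w : slit_dom b w ->
  lsubmx (ct_pushforward b w) *m (rsubmx w)^T = 0.
Proof.
move=> bw; have [ow|now] := pselect (chart_dom o (basept b w)); last first.
  by rewrite ct_pushforward_out // linear0 mul0mx.
have bow : ct_overlap b o w by split=> //; case: bw.
rewrite ct_pushforwardE //; have oz := slit_dom_ct bw bow.
set z := ct_transition b o w in oz *.
have obz : ct_overlap o b z by apply: ct_overlap_transition => //; exact: overlap_id bow.1.
have rw : rsubmx w = rsubmx z *m ('J (transition b o) (transition o b (lsubmx z)))^T.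
  apply: etrans (congr1 (@rsubmx R 1 n n) (esym (ct_transitionK bow))) _.
  apply: etrans (congr1 (@rsubmx R 1 n n) (ct_transitionE obz)) _.
  exact: row_mxKr.
(* Chain rule for the identity between projecting after the change of induced coordinates and
   changing coordinates after projecting. *)
have lY : lsubmx (Y z *m 'J (ct_transition o b) z) =
    lsubmx (Y z) *m 'J (transition o b) (lsubmx z).
  have dl u : differentiable (@lsubmx R 1 n n) u by exact: differentiable_lsubmx.
  apply: etrans (esym (mul_jacobian_lsubmx _ (ct_transition o b z))) _.
  apply: etrans _ (congr1 (mulmx^~ _) (mul_jacobian_lsubmx (Y z) z)).
  rewrite -!mulmxA; apply: (congr1 (mulmx (Y z))).
  apply: etrans (esym (jacobian_comp (ct_transition_diff obz) (dl _))) _.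
  apply: etrans _ (jacobian_comp (dl z) (transition_diff obz)).
  by congr ('J _ z); rewrite funeqE => u; exact: lsubmx_ct.
rewrite rw lY trmx_mul trmxK -mulmxA [_ *m (_ *m (rsubmx z)^T)]mulmxA.
by rewrite jacobian_transitionK // mul1mx Ybase.
Qed.

Variable K : cartan_space M.
Hypothesis YK : forall z, slit_dom o z -> dir Y (K o) z = 0.

(** The change of induced coordinates carries [K o] to [K b] by [K_compat] and Y to its pushforward,
    hence preserves the derivative. *)
Lemma ct_pushforward_dir b w : slit_dom b w -> dir (ct_pushforward b) (K b) w = 0.
Proof.
move=> bw; have [ow|now] := pselect (chart_dom o (basept b w)); last first.
  by rewrite /dir ct_pushforward_out // big1 // => i _; rewrite mxE mul0r.
have bow : ct_overlap b o w by split=> //; case: bw.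
have oz := slit_dom_ct bw bow.
set z := ct_transition b o w in oz *.
have obz : ct_overlap o b z by apply: ct_overlap_transition => //; exact: overlap_id bow.1.
have wz : ct_transition o b z = w by exact: ct_transitionK.
have dct := ct_transition_diff obz.
have dK u : u = w -> differentiable (K b) u.
  by move=> ->; exact: smooth_diff (K_smooth K b) bw.
have E : ct_pushforward b (ct_transition o b z) = Y z *m 'J (ct_transition o b) z.
  by apply: etrans (congr1 _ wz) _; rewrite ct_pushforwardE.
apply: etrans (congr1 (dir _ _) (esym wz)) _.
apply: etrans (esym (dir_comp dct (dK _ wz) E)) _.
rewrite -[RHS](YK oz); apply: near_eq_dir.
by apply: (open_near (@ct_overlap_open _ _ M o b) obz) => u [ou bu]; rewrite K_compat.
Qed.

End Pushforward.

(** * Cutoff functions on the base *)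

Lemma bump_exists (R : realType) (n : nat) (U : set 'rV[R]_n) (x0 : 'rV[R]_n) :
  open U -> U x0 ->
  exists (phi : 'rV[R]_n -> R) (C : set 'rV[R]_n),
    [/\ smooth setT phi, phi x0 = 1, compact C, C `<=` U &
        forall x, ~ C x -> phi x = 0].
Proof.
move=> oU Ux0; have : nbhs x0 U by exact: open_nbhs_nbhs.
move=> /nbhs_ballP [e /= e0 He].
pose r := e / 2; have r0 : 0 < r by rewrite divr_gt0.
pose q (x : 'rV[R]_n) := r ^+ 2 - \sum_i (x 0 i - x0 0 i) * (x 0 i - x0 0 i).
have q0 : q x0 = r ^+ 2.
  by rewrite /q big1 ?subr0 // => i _; rewrite subrr mul0r.
have f0 : flat 0 (r ^+ 2) != 0 :> R.
  rewrite /flat exprn_gt0 // mulf_neq0 // ?expf_neq0 ?invr_neq0 ?gt_eqF //.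
    by rewrite exprn_gt0.
  exact: expR_gt0.
(* A closed cube: compact as a product of segments, contained in the sup-norm ball of radius e = 2
   r, and containing the Euclidean ball of radius r outside which [flat 0 (q x)] vanishes. *)
pose C := [set x : 'rV[R]_n | forall i, `[x0 0 i - r, x0 0 i + r]%classic (x ord0 i)].
exists (fun x => (flat 0 (r ^+ 2))^-1 * flat 0 (q x)), C; split.
- apply: smoothM; [exact: openT|exact: smooth_cst|].
  apply: smooth_flat; first exact: openT.
  apply: smoothB; [exact: openT|exact: smooth_cst|].
  apply: smooth_sum; first exact: openT.
  move=> i _; apply: smoothM; first exact: openT.
    by apply: smoothB; [exact: openT|exact: smooth_coord|exact: smooth_cst].
  by apply: smoothB; [exact: openT|exact: smooth_coord|exact: smooth_cst].
- by rewrite q0 mulVf.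
- apply: (@rV_compact _ _ (fun i => `[x0 0 i - r, x0 0 i + r]%classic)) => i.
  exact: segment_compact.
- move=> x Cx; apply: He; split=> // i j; rewrite ord1.
  have := Cx j; rewrite /= in_itv /= => /andP[h1 h2].
  rewrite /ball /= ltr_norml; rewrite /r in h1 h2; apply/andP; split; lra.
- move=> x nCx; rewrite [flat 0 (q x)]flat_le0 ?mulr0 //.
  have [i nxi] : exists i, ~ `[x0 0 i - r, x0 0 i + r]%classic (x ord0 i).
    by apply/existsNP.
  have di : r < `|x 0 i - x0 0 i|.
    rewrite ltNge; apply/negP => dr; apply: nxi.
    by move: dr; rewrite /= in_itv /= ler_distl.
  rewrite /q subr_le0 (bigD1 i) //=; apply: (@le_trans _ _ (`|x 0 i - x0 0 i| ^+ 2)).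
    by rewrite lerXn2r ?nnegrE ?normr_ge0 ?(ltW r0) ?(ltW di).
  rewrite -normrX ger0_norm ?sqr_ge0 // expr2 lerDl.
  by apply: sumr_ge0 => j _; rewrite -expr2 sqr_ge0.
Qed.

(** * The equivalences on a Cartan space *)

Section Cartan.
Context {R : realType} {n : nat} {M : smooth_manifold R n} (K : cartan_space M).
Implicit Types (a b : chart M) (z : 'rV[R]_(n + n)) (X Y : slit_vector_field M).

Lemma cartan_function_chart a : cartan_function (slit_dom a) (K a).
Proof.
split; first exact: slit_dom_open.
- move=> z t [az z0] t0; split; first by rewrite /ct_dom /= row_mxKl.
  by rewrite row_mxKr scaler_eq0 negb_or gt_eqF.
- exact: K_smooth.
- exact: K_pos.
- by move=> z t [az _] t0; rewrite /fiber_scale K_homogeneous ?hsubmxK.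
- exact: K_posdef.
Qed.

Let cfK := cartan_function_chart.

Lemma vf_mdiff X a z : slit_dom a z -> mdiff (X a) z.
Proof. by move=> az i j; rewrite ord1; exact: smooth_diff (vf_smooth X a j) az. Qed.

(** [tangent_field] meets both conditions at every point of the slit domain, and they survive
    multiplication by a function. The cutoff is pulled back from the base because [ct_pushforward]
    asks for compact support in the base only. *)
Lemma global_tangent_field (c : R) a z (w : 'rV[R]_(n + n)) : slit_dom a z ->
  dir (fun=> w) (K a) z = 0 -> lsubmx w *m (rsubmx z)^T = 0 ->
  exists X, [/\ tangent_to_indicatrix K c X, orthogonal_to_xi K c X & X a z = w].
Proof.
move=> az wt wb.
have [phi [C [sphi phi1 cC CU phi0]]] := bump_exists (@coord_open _ _ M a) az.1.
pose T := tangent_field (K a) w.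
pose Y z : 'rV[R]_(n + n) := phi (lsubmx z) *: T z.
have sT : smooth_map (slit_dom a) T.
  exact: (tangent_field_smooth (cfK a)).
have sphi' : smooth (slit_dom a) (fun z => phi (lsubmx z)).
  exact: smooth_comp (cf_open (cfK a)) _ (smooth_lsubmx _) sphi.
have sY : smooth_map (slit_dom a) Y.
  move=> b; under eq_fun do rewrite scalemxE.
  exact: smoothM (cf_open (cfK a)) sphi' (sT b).
have YC u : slit_dom a u -> ~ C (lsubmx u) -> Y u = 0.
  by move=> _ nC; rewrite /Y phi0 // scale0r.
have Yb u : slit_dom a u -> lsubmx (Y u) *m (rsubmx u)^T = 0.
  move=> au; rewrite /Y linearZ /= -scalemxAl.
  by rewrite (tangent_field_base (cfK a) w au) scaler0.
have YK u : slit_dom a u -> dir Y (K a) u = 0.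
  move=> au; have := dir_tangent_field (cfK a) w au.
  have dK := smooth_diff (cf_smooth (cfK a)) au.
  by rewrite !dirE // /Y linearZ /= => ->; rewrite scaler0.
pose X := @SlitVectorField R n M (ct_pushforward a Y) (ct_pushforward_smooth sY cC CU YC)
  (@ct_pushforward_compat _ _ _ a Y).
exists X; split.
- move=> b u [bu _]; exact: (ct_pushforward_dir YK bu).
- move=> b u [bu _]; rewrite /G.
  rewrite (inner_xi (cfK b) _ bu).
  by rewrite /hor (ct_pushforward_base Yb bu) mxE.
- rewrite /= (ct_pushforward_chart Y az) /Y phi1 scale1r.
  exact: tangent_field_id.
Qed.

Lemma lie_metric_xi_tangent c X Y a z :
  tangent_to_indicatrix K c X -> tangent_to_indicatrix K c Y -> indicatrix K c a z ->
  lie_metric (sasaki_mx (K a)) (xi (K a)) (X a) (Y a) z =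
  (hor (X a) z *m angular_mx (K a) z *m gup (K a) z *m (ver (K a) (Y a) z)^T +
   hor (Y a) z *m angular_mx (K a) z *m gup (K a) z *m (ver (K a) (X a) z)^T) 0 0.
Proof.
move=> tX tY Iz; have [az _] := Iz.
have := tX a z Iz; move/(dir_K_eq0 (cfK a) _ az) => vX.
have := tY a z Iz; move/(dir_K_eq0 (cfK a) _ az) => vY.
exact: (lie_metric_xi_angular (cfK a) az (vf_mdiff X az) (vf_mdiff Y az) vX vY).
Qed.

Lemma angular_curvature_vanishesP c : angular_curvature_vanishes K c <->
  forall a z, indicatrix K c a z -> angular_mx (K a) z = 0.
Proof.
split=> H a z Iz; first by apply/matrixP => i j; rewrite mxE [RHS]mxE; exact: H.
by move=> i j; have /matrixP/(_ i j) := H a z Iz; rewrite mxE [RHS]mxE.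
Qed.

Lemma angular_killing c : angular_curvature_vanishes K c -> xi_killing K c.
Proof.
move=> /angular_curvature_vanishesP H X Y tX tY a z Iz.
by rewrite (lie_metric_xi_tangent tX tY Iz) H // !mulmx0 !mul0mx addr0 mxE.
Qed.

Lemma nabla_sym_lie_metric c X Y a z : 0 < c ->
  tangent_to_indicatrix K c X -> tangent_to_indicatrix K c Y ->
  orthogonal_to_xi K c X -> orthogonal_to_xi K c Y -> indicatrix K c a z ->
  G K a (nabla (sasaki_mx (K a)) (X a) (Y a)) (xi (K a)) z
  + G K a (nabla (sasaki_mx (K a)) (Y a) (X a)) (xi (K a)) z =
  - lie_metric (sasaki_mx (K a)) (xi (K a)) (X a) (Y a) z.
Proof.
move=> c0 tX tY oX oY Iz; have [az Kz] := Iz.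
have gs : \forall w \near z, (sasaki_mx (K a) w)^T = sasaki_mx (K a) w.
  by apply: (near_eq_dom (cfK a) az) => w aw; exact: (sasaki_mx_sym (cfK a) aw).
have gu := sasaki_mx_unit (cfK a) az.
have sg := sasaki_mx_smooth (cfK a).
have dg := smooth_mx_diff sg az.
have dxi : mdiff (xi (K a)) z.
  by move=> i j; rewrite ord1; exact: smooth_diff (xi_smooth (cfK a) j) az.
rewrite /G (inner_nabla_sym gs gu dg (vf_mdiff X az) (vf_mdiff Y az) dxi).
(* G(V, xi) is known to vanish on the indicatrix only; U is tangent to it, so [dir_eq0_level]
   applies. *)
have D0 (U V : slit_vector_field M) : tangent_to_indicatrix K c U ->
    orthogonal_to_xi K c V -> dir (U a) (inner (sasaki_mx (K a)) (V a) (xi (K a))) z = 0.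
  move=> tU oV; apply: (dir_eq0_level (cfK a) c0 az Kz _ _ (tU a z Iz)).
    rewrite (_ : inner _ _ _ = fun w => (V a w *m sasaki_mx (K a) w *m (xi (K a) w)^T) 0 0).
      by apply: mdiffM; [apply: mdiffM => //; exact: vf_mdiff|exact: mdiffT].
    by rewrite funeqE => w; exact: innerE.
  by move=> w aw Kw; exact: (oV a w (conj aw Kw)).
by rewrite !D0 // addr0 sub0r.
Qed.

Lemma killing_bundle_like c : 0 < c -> xi_killing K c -> bundle_like K c.
Proof.
move=> c0 H X Y tX tY oX oY a z Iz.
by rewrite (nabla_sym_lie_metric c0 tX tY oX oY Iz) H // oppr0.
Qed.

Lemma bundle_like_angular c : 0 < c -> bundle_like K c -> angular_curvature_vanishes K c.
Proof.
move=> c0 H; apply/angular_curvature_vanishesP => a z Iz; have [az Kz] := Iz.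
apply: (angular_mx_eq0 (cfK a) az) => u v uz vz.
(* With the horizontal lift of u and the vertical vector v, a single mixed term of L_xi G survives.
   Horizontal vectors are tangent to the level sets and v is so by [vz]; orthogonality to [xi]
   concerns base parts only. *)
pose wu : 'rV[R]_(n + n) := row_mx u (u *m (Nmx (K a) z)^T).
pose wv : 'rV[R]_(n + n) := row_mx 0 v.
have hu : hor (fun=> wu) z = u by rewrite /hor row_mxKl.
have vu : ver (K a) (fun=> wu) z = 0 by rewrite /ver hu row_mxKr subrr.
have hv : hor (fun=> wv) z = 0 by rewrite /hor row_mxKl.
have vv : ver (K a) (fun=> wv) z = v by rewrite /ver hv row_mxKr mul0mx subr0.
have tu : dir (fun=> wu) (K a) z = 0.
  by apply/(dir_K_eq0 (cfK a) _ az); rewrite vu mul0mx.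
have tv : dir (fun=> wv) (K a) z = 0 by apply/(dir_K_eq0 (cfK a) _ az); rewrite vv.
have [|X [tX oX Xz]] := global_tangent_field c az tu; first by rewrite row_mxKl.
have [|Y [tY oY Yz]] := global_tangent_field c az tv; first by rewrite row_mxKl mul0mx.
have := nabla_sym_lie_metric c0 tX tY oX oY Iz; rewrite H // => /esym/eqP.
rewrite oppr_eq0 (lie_metric_xi_tangent tX tY Iz).
have hX : hor (X a) z = u by rewrite -hu /hor Xz.
have hY : hor (Y a) z = 0 by rewrite -hv /hor Yz.
have vY : ver (K a) (Y a) z = v by rewrite -vv /ver /hor Yz.
rewrite hX hY vY !mul0mx addr0 => /eqP E.
by rewrite [LHS]mx11_scalar E raddf0.
Qed.

Lemma constant_curvature_angular c k : - (c ^+ 2 * k) = 1 ->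
  constant_curvature K k -> angular_curvature_vanishes K c.
Proof.
move=> hck H a z [az Kz] i j; rewrite /angular_curvature H // /Ksq Kz.
have -> : k * c ^+ 2 = -1 by rewrite -hck opprK mulrC.
by rewrite mulN1r addNr.
Qed.

(** The dilation by t = c / K(z) brings z to the indicatrix. There the vanishing reads t^2 R_ij +
    h_ij = 0 in terms of the values at z, that is R_ij = - (K^2 / c^2) h_ij, and - 1 / c^2 is k. *)
Lemma angular_constant_curvature c k : 0 < c -> - (c ^+ 2 * k) = 1 ->
  angular_curvature_vanishes K c -> constant_curvature K k.
Proof.
move=> c0 hck H a z az i j; have Kz := cf_gt0 (cfK a) az.
have t0 : 0 < c / K a z by rewrite divr_gt0.
have Iz : indicatrix K c a (fiber_scale (c / K a z) z).
  split; first exact: (cf_conic (cfK a) az t0).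
  by rewrite (cf_homogeneous (cfK a) az t0) divfK // gt_eqF.
have := H _ _ Iz i j; rewrite /angular_curvature.
rewrite (scales_Rtensor (cfK a) t0 i j az) (scales_angular_metric (cfK a) t0 i j az).
rewrite mul1r /Ksq; move: Kz (Rtensor _ _ _ _) (angular_metric _ _ _ _).
move: (K a z) => x x0 r h E.
have xn : x != 0 by rewrite gt_eqF.
have cn : c != 0 by rewrite gt_eqF.
have -> : h = - ((c / x) ^+ 2 * r) by apply/eqP; rewrite -addr_eq0 addrC E.
have -> : k = - c ^- 2.
  by apply: (mulfI (expf_neq0 2 cn)); rewrite mulrN divff ?expf_neq0 // -hck opprK.
by field; rewrite xn cn.
Qed.

End Cartan.

Theorem theorem4p13 (R : realType) (n : nat) (M : smooth_manifold R n)
  (K : cartan_space M) (c k : R) (hk : k < 0) (hc : 0 < c)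
  (hck : - (c ^+ 2 * k) = 1) :
  [<-> constant_curvature K k;
       bundle_like K c;
       xi_killing K c;
       angular_curvature_vanishes K c].
Proof.
(* The cycle in the stated order is assembled from the implications (1) => (4) => (3) => (2) => (4)
   => (1). *)
split=> [/(constant_curvature_angular hck)/angular_killing/(killing_bundle_like hc) //|].
split=> [/(bundle_like_angular hc)/angular_killing //|].
split=> [/(killing_bundle_like hc)/(bundle_like_angular hc) //|].
exact: (angular_constant_curvature hc hck).
Qed.
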